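(* If $E$ is a separable quasi-Banach symmetric function space on $(0,1)$ with $E\subset L_1$, then the identity operator $\mathrm{id}:E\to E$ is a sum of two narrow operators bounded from $E$ into $\mathcal{S}_E$.
   Context: All functions are real-valued measurable functions on $(0,1)$ with Lebesgue measure $m$, identified when equal a.e.; $L_1=L_1(0,1)$. Decreasing rearrangement: $\mu(x)=\mu(\cdot;x)$, $\mu(t;x):=\inf\{s\ge 0: m(\{u:|x(u)|>s\})\le t\}$. A quasi-Banach symmetric function space on $(0,1)$ is a complete quasi-normed space $(E,\|\cdot\|_E)$ of measurable functions on $(0,1)$ such that: if $x\in E$ and $y$ is measurable with $|y|\le|x|$, then $y\in E$ and $\|y\|_E\le\|x\|_E$; if $x\in E$ and $y$ is measurable with $\mu(y)=\mu(x)$, then $y\in E$ and $\|y\|_E=\|x\|_E$. Calderón operator: $(Sx)(t)=\frac1t\int_0^t x(s)\,ds+\int_t^1\frac{x(s)}{s}\,ds$, $x\in L_1$. $L_{1,\infty}(0,1)$ is the space of measurable $x$ with $\sup_{0<t\le1}t\mu(t;x)<\infty$. Define $\mathcal{S}_E=\{x\in L_{1,\infty}(0,1):\exists y\in E,\ \mu(x)\le S\mu(y)\}$ with $\|x\|_{\mathcal{S}_E}=\inf\{\|y\|_E: y\in E,\ \mu(x)\le S\mu(y)\}$; this is a quasi-Banach symmetric function space. Narrow operator: for an $F$-space $X$, a bounded linear operator $R:E\to X$ is narrow if for each measurable set $A\subset(0,1)$ and every $\varepsilon>0$ there exists a sign $x$ on $A$ (a measurable function supported on $A$ taking values in $\{-1,1\}$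 on $A$) such that $\|Rx\|_X<\varepsilon$. *)

(* Defs.v *)
(* MathComp-Analysis. *)
From HB Require Import structures.
From mathcomp Require Import all_boot all_order all_algebra.
From mathcomp Require Import all_classical all_reals all_analysis.
Set Implicit Arguments.
Unset Strict Implicit.
Unset Printing Implicit Defensive.
Import Order.TTheory GRing.Theory Num.Theory.
Import numFieldNormedType.Exports.
Local Open Scope classical_set_scope.
Local Open Scope ring_scope.

(* A function on (0,1) is represented by some x : R -> R, of which only the
   restriction to ]0, 1[ matters.  Functions are not quotiented by a.e. equality:
   equality of classes is [eq01], a space of classes is a set of representatives
   stable under [eq01], and an operator between such spaces is a map on
   representatives compatible with [eq01].  Measurable means Borel measurable:
   a Lebesgue measurable function (or set) has a Borel representative. *)

Definition unit_itv {R : realType} : set R := `]0, 1[%classic.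

Definition meas01 (R : realType) (x : R -> R) : Prop :=
  measurable_fun unit_itv x.

Definition eq01 (R : realType) (x y : R -> R) : Prop :=
  ae_eq (@lebesgue_measure R) unit_itv x y.

Definition le01 (R : realType) (x y : R -> R) : Prop :=
  {ae (@lebesgue_measure R), forall t, unit_itv t -> x t <= y t}.

(* Only meaningful for t > 0: the set below is then nonempty, since x is
   finite-valued. *)
Definition rearr (R : realType) (x : R -> R) (t : R) : R :=
  inf [set s : R | 0 <= s /\
    (@lebesgue_measure R [set u | unit_itv u /\ (s < `|x u|)%R]
       <= t%:E)%E].

Definition in_L1 (R : realType) : set (R -> R) :=
  [set x | (@lebesgue_measure R).-integrable unit_itv (EFin \o x)].

Definition in_L1infty (R : realType) : set (R -> R) :=
  [set x | meas01 x /\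
    exists C : R, forall t, 0 < t <= 1 -> t * rearr x t <= C].

(* Only meaningful for x in L_1 and 0 < t < 1 (Rintegral is 0 on
   non-integrable functions). *)
Definition calderon (R : realType) (x : R -> R) (t : R) : R :=
  t^-1 * Rintegral (@lebesgue_measure R) (`]0, t[%classic : set R) x
  + Rintegral (@lebesgue_measure R) (`]t, 1[%classic : set R) (fun s => x s / s).

Record quasi_normed_function_space (R : realType) (E : set (R -> R))
    (N : (R -> R) -> R) : Prop := {
  qn_meas : forall x, E x -> meas01 x ;
  qn_ae : forall x y, E x -> meas01 y -> eq01 x y -> E y /\ N y = N x ;
  qn_zero : E (cst 0) ;
  qn_add : forall x y, E x -> E y -> E (x \+ y) ;
  qn_scale : forall (a : R) x, E x -> E (a \*o x) ;
  qn_ge0 : forall x, E x -> 0 <= N x ;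
  qn_eq0 : forall x, E x -> (N x = 0 <-> eq01 x (cst 0)) ;
  qn_homogeneous : forall (a : R) x, E x -> N (a \*o x) = `|a| * N x ;
  qn_quasi_triangle : exists K : R,
    forall x y, E x -> E y -> N (x \+ y) <= K * (N x + N y)
}.

Definition quasi_complete (R : realType) (E : set (R -> R))
    (N : (R -> R) -> R) : Prop :=
  forall u : nat -> R -> R, (forall n, E (u n)) ->
    (forall eps : R, 0 < eps -> exists n0 : nat, forall m n : nat,
       (n0 <= m)%N -> (n0 <= n)%N -> N (u m \- u n) < eps) ->
  exists2 x, E x & (fun n => N (u n \- x)) @ \oo --> (0 : R).

Record quasi_banach_symmetric (R : realType) (E : set (R -> R))
    (N : (R -> R) -> R) : Prop := {
  qbs_space : quasi_normed_function_space E N ;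
  qbs_complete : quasi_complete E N ;
  qbs_ideal : forall x y, E x -> meas01 y ->
    le01 (fun t => `|y t|) (fun t => `|x t|) -> E y /\ N y <= N x ;
  qbs_symmetric : forall x y, E x -> meas01 y ->
    (forall t, 0 < t < 1 -> rearr y t = rearr x t) -> E y /\ N y = N x
}.

Definition quasi_separable (R : realType) (E : set (R -> R))
    (N : (R -> R) -> R) : Prop :=
  exists d : nat -> R -> R, (forall n, E (d n)) /\
    forall x, E x -> forall eps : R, 0 < eps -> exists n, N (x \- d n) < eps.

Definition calderon_dominated (R : realType) (x y : R -> R) : Prop :=
  forall t, 0 < t < 1 -> rearr x t <= calderon (rearr y) t.

(* The space S_E and its quasi-norm, for E contained in L_1. *)
Definition calderon_space (R : realType) (E : set (R -> R)) : set (R -> R) :=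
  [set x | in_L1infty x /\ exists2 y, E y & calderon_dominated x y].

Definition calderon_norm (R : realType) (E : set (R -> R))
    (N : (R -> R) -> R) (x : R -> R) : R :=
  inf [set N y | y in [set y | E y /\ calderon_dominated x y]].

Record bounded_linear_operator (R : realType) (E : set (R -> R))
    (NE : (R -> R) -> R) (X : set (R -> R)) (NX : (R -> R) -> R)
    (T : (R -> R) -> (R -> R)) : Prop := {
  blo_maps : forall x, E x -> X (T x) ;
  blo_ae : forall x y, E x -> E y -> eq01 x y -> eq01 (T x) (T y) ;
  blo_add : forall x y, E x -> E y -> eq01 (T (x \+ y)) (T x \+ T y) ;
  blo_scale : forall (a : R) x, E x -> eq01 (T (a \*o x)) (a \*o T x) ;
  blo_bounded : exists C : R, forall x, E x -> NX (T x) <= C * NE x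
}.

Definition sign_on (R : realType) (A : set R) (x : R -> R) : Prop :=
  meas01 x /\ forall t, 0 < t < 1 ->
    (A t -> x t = 1 \/ x t = -1) /\ (~ A t -> x t = 0).

Definition narrow_operator (R : realType) (E : set (R -> R))
    (NE : (R -> R) -> R) (X : set (R -> R)) (NX : (R -> R) -> R)
    (T : (R -> R) -> (R -> R)) : Prop :=
  bounded_linear_operator E NE X NX T /\
  forall A : set R, measurable A -> A `<=` unit_itv ->
  forall eps : R, 0 < eps ->
  exists x, [/\ sign_on A x, E x & NX (T x) < eps].

(* Main.v *)
Require Import Defs.
From HB Require Import structures.
From mathcomp Require Import all_boot all_order all_algebra.
From mathcomp Require Import all_classical all_reals all_analysis.
From mathcomp Require Import archimedean measurable_realfun lra.
Import Order.TTheory GRing.Theory Num.Theory.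
Import numFieldNormedType.Exports.
Set Implicit Arguments.
Unset Strict Implicit.
Unset Printing Implicit Defensive.
Local Open Scope classical_set_scope.
Local Open Scope ring_scope.

(** Let E_n be the conditional expectation on the dyadic intervals of level n,
    with E_(-1) = 0.  For a set th of levels, the martingale transform T_th is
    the sum of the differences E_n - E_(n-1) over the n in th.  Taking for th
    the odd levels and then the even levels gives two operators whose sum is
    the identity; these are the two narrow operators.

    Boundedness from E into S_E follows from the pointwise estimate
    rearr (T x) t <= 7 * calderon (rearr x) t, since calderon is homogeneous.
    Fix t, let M = rearr x t, and split x into its part above M (where
    |x| > M) and its part below M.  The part above M has L_1 norm at most the
    integral of rearr x over (0, t), and T has weak type (1, 1) with constant 1
    ([mtransform_weak]): this is Burkholder's argument, where a function of
    (T_th x, x - T_th x) that is concave in each variable makes the relevant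
    means nonincreasing in the level, so that no stopping time is needed.  The
    part below M is treated by duality ([Tn_dual]): T is self-adjoint, and if w
    is a sign on a set of measure a, then the bounds |T w|_2 <= a^(1/2) and
    |{|T w| > s}| <= a / s give an integral of |T w| over a set B of measure at
    most 2^(k+1) t that is at most a (2 k + 5), when t <= 2 a
    ([int_Tn_indic_le]).  Cutting x at the levels rearr x (2^k t) and summing by
    parts, the part below M contributes at most 5 M plus four times the integral
    of rearr x u / u over (t, 1) ([below_bound]).

    These estimates are proved for the truncations Tn, which only involve
    finite sums.  As dyadic step functions are dense in L_1, where the
    truncations are eventually constant, the weak type inequality makes
    Tn n x converge in measure for every x in L_1 ([Tlim_ex]), and the bounds
    pass to the limit T x.

    For narrowness ([Tlimit_narrow]), let n + 1 be a level outside th, let r be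
    the Rademacher function of level n + 1, and let B be a union of dyadic
    intervals of level n.  Then T kills 1_B r, so T (1_A r) = T (1_A r - 1_B r)
    for every measurable A.  Choosing B close to A in measure makes
    1_A r - 1_B r small in E, because separability forces the quasi-norm of 1_D
    to tend to 0 with the measure of D ([indic_norm_small]). *)

(** * Martingale transforms on the dyadic tree *)

Section Discrete.
Variable R : realType.
Implicit Types (f w : nat -> nat -> R) (a b : nat -> R) (th : nat -> bool).

(** The mean of a over the 2 ^ n dyadic intervals of level n. *)
Definition mean n a : R := 2^-1 ^+ n * \sum_(j < 2 ^ n) a j.

(** A dyadic martingale: f n j is the value on the j-th interval of level n,
    whose halves are the intervals 2 j and 2 j + 1 of level n + 1. *)
Definition dmart f := forall n j, f n j = (f n.+1 j.*2 + f n.+1 j.*2.+1) / 2.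

(** The transform keeps the martingale differences whose level n satisfies
    [th n]; at level 0 the difference is f 0 itself. *)
Fixpoint mtransform th f n j : R :=
  if n is m.+1 then
    mtransform th f m j./2 + (if th n then f n j - f m j./2 else 0)
  else (if th 0%N then f 0%N j else 0).

Lemma eq_mean n a b : (forall j, (j < 2 ^ n)%N -> a j = b j) -> mean n a = mean n b.
Proof. by move=> ab; congr (_ * _); apply: eq_bigr => j _; exact: ab. Qed.

Lemma le_mean n a b : (forall j, (j < 2 ^ n)%N -> a j <= b j) -> mean n a <= mean n b.
Proof.
move=> ab; rewrite /mean ler_wpM2l ?exprn_ge0//.
by apply: ler_sum => j _; exact: ab.
Qed.

Lemma meanB n a b : mean n (fun j => a j - b j) = mean n a - mean n b.
Proof. by rewrite /mean big_split/= sumrN mulrBr. Qed.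

Lemma meanZ n c a : mean n (fun j => c * a j) = c * mean n a.
Proof. by rewrite /mean -mulr_sumr mulrCA. Qed.

Lemma sum_double n a :
  \sum_(j < n.*2) a j = \sum_(j < n) (a j.*2 + a j.*2.+1).
Proof.
elim: n => [|n ih]; first by rewrite !big_ord0.
by rewrite doubleS !big_ord_recr/= ih addrA.
Qed.

Lemma mean_pair n a :
  mean n.+1 a = mean n (fun j => (a j.*2 + a j.*2.+1) / 2).
Proof.
rewrite /mean expnS mul2n sum_double exprS -mulr_suml.
lra.
Qed.

Lemma mean_0 a : mean 0 a = a 0%N.
Proof. by rewrite /mean expr0 mul1r big_ord1. Qed.

Section transform.
Variable th : nat -> bool.

Lemma mtransformD f w n j :
  mtransform th (fun n j => f n j + w n j) n j =
  mtransform th f n j + mtransform th w n j.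
Proof.
elim: n j => [|n ih] j /=; case: (th _); rewrite ?addr0 ?ih//; lra.
Qed.

Lemma mtransformZ c f n j :
  mtransform th (fun n j => c * f n j) n j = c * mtransform th f n j.
Proof.
elim: n j => [|n ih] j /=; case: (th _); rewrite ?mulr0 ?ih//; lra.
Qed.

Lemma mtransform_compl f n j :
  mtransform th f n j + mtransform (negb \o th) f n j = f n j.
Proof.
elim: n j => [|n ih] j /=; first by case: (th _) => /=; rewrite ?addr0 ?add0r.
rewrite addrACA ih; case: (th _) => /=; lra.
Qed.

(** If Phi is midpoint concave in each variable, the mean of
    Phi (T f, f - T f) does not increase with the level, since passing to the next
    level moves exactly one of the two variables, symmetrically; at level 0 one of
    the variables is 0. *)
Lemma mean_zigzag (Phi : R -> R -> R) f n : dmart f ->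
  (forall p q h, Phi (p + h) q + Phi (p - h) q <= 2 * Phi p q) ->
  (forall p q h, Phi p (q + h) + Phi p (q - h) <= 2 * Phi p q) ->
  (forall p, Phi p 0 <= 0) -> (forall q, Phi 0 q <= 0) ->
  mean n (fun j => Phi (mtransform th f n j) (f n j - mtransform th f n j)) <= 0.
Proof.
move=> mf cp cq p0 q0; elim: n => [|n ih].
  by rewrite mean_0 /=; case: (th 0%N); rewrite ?subrr ?subr0.
apply: le_trans ih; rewrite mean_pair; apply: le_mean => j _ /=.
rewrite uphalf_double doubleK.
set p := mtransform th f n j.
pose h := f n.+1 j.*2 - f n j.
have -> : f n.+1 j.*2.+1 - f n j = - h by rewrite /h (mf n j); lra.
have -> : f n.+1 j.*2.+1 = f n j - h by rewrite /h (mf n j); lra.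
have -> : f n.+1 j.*2 = f n j + h by rewrite /h; lra.
rewrite ler_pdivrMr// [leRHS]mulrC.
case: (th n.+1); rewrite ?addr0.
  apply: le_trans (cp p (f n j - p) h).
  by rewrite le_eqVlt; apply/orP; left; apply/eqP; congr (Phi _ _ + Phi _ _); lra.
apply: le_trans (cq p (f n j - p) h).
by rewrite le_eqVlt; apply/orP; left; apply/eqP; congr (Phi _ _ + Phi _ _); lra.
Qed.

(** Burkholder's function for the weak type inequality, in the coordinates
    p = T f and q = f - T f. *)
Definition zigzag (p q : R) : R :=
  if (`|p| <= 1) && (`|q| <= 1) then - (p * q) else 1 - `|p + q|.

Lemma zigzagC p q : zigzag p q = zigzag q p.
Proof. by rewrite /zigzag andbC [p * q]mulrC [p + q]addrC. Qed.

(** For |q| <= 1, zigzag is at most both of the functions of p that define it, so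
    it is their minimum; both are concave in p. *)
Lemma zigzag_le_min p q : `|q| <= 1 ->
  zigzag p q <= - (p * q) /\ zigzag p q <= 1 - `|p + q|.
Proof.
rewrite /zigzag => q3; have /andP[q1 q2] : -1 <= q <= 1 by rewrite -ler_norml.
rewrite q3 andbT; case: ifPn => [|].
  rewrite ler_norml => /andP[p1 p2]; split => //.
  have : 0 <= (1 - p) * (1 - q) by rewrite mulr_ge0 ?subr_ge0.
  have : 0 <= (p + 1) * (q + 1) by rewrite mulr_ge0//; lra.
  case: (ger0P (p + q)); lra.
rewrite ler_norml negb_and -!ltNge => /orP[p1|p1]; split => //.
  have : 0 <= (- 1 - p) * (q + 1) by rewrite mulr_ge0//; lra.
  have := ler_norm (- (p + q)); rewrite normrN; lra.
have : 0 <= (p - 1) * (1 - q) by rewrite mulr_ge0//; lra.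
have := ler_norm (p + q); lra.
Qed.

Lemma zigzag_concave p q h : zigzag (p + h) q + zigzag (p - h) q <= 2 * zigzag p q.
Proof.
have T : 2 * `|p + q| <= `|p + h + q| + `|p - h + q|.
  have := ler_normD (p + h + q) (p - h + q).
  have -> : p + h + q + (p - h + q) = 2 * (p + q) by lra.
  by rewrite normrM ger0_norm.
case: (lerP `|q| 1) => q1.
  have [] := zigzag_le_min (p + h) q1; have [] := zigzag_le_min (p - h) q1.
  rewrite [in X in _ -> _ -> _ -> _ -> _ <= X]/zigzag; case: ifP => _; lra.
rewrite /zigzag [`|q| <= 1]leNgt q1/= !andbF; lra.
Qed.

(** The majorization that turns [mean_zigzag] into a weak type bound. *)
Lemma zigzag_ge p q : (1 < `|p|)%R%:R - `|p + q| <= zigzag p q.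
Proof.
rewrite /zigzag; case: (lerP `|p| 1) => p1 /=; last by [].
case: (lerP `|q| 1) => q1 /=; last lra.
have [pq|pq] := leP (p * q) 0; first by have := normr_ge0 (p + q); lra.
have : `|p * q| <= `|p + q|.
  have -> : `|p + q| = `|p| + `|q|.
    apply/eqP; rewrite -[_ == _]/(_ == _); move: pq.
    case: (ltrgt0P p) => p0; case: (ltrgt0P q) => q0; rewrite ?(p0, q0) => pq; try nra.
    by rewrite ger0_norm ?addr_ge0// ltW.
    by rewrite ler0_norm; lra.
  rewrite normrM.
  have : `|p| * `|q| <= `|p| * 1 by rewrite ler_wpM2l.
  have := normr_ge0 q; lra.
rewrite gtr0_norm//; lra.
Qed.

Lemma mtransform_weak f n l : dmart f -> 0 < l ->
  l * mean n (fun j => (l < `|mtransform th f n j|)%R%:R) <= mean n (fun j => `|f n j|).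
Proof.
move=> mf l0; rewrite -meanZ -subr_le0 -meanB.
pose Phi p q := l * zigzag (l^-1 * p) (l^-1 * q).
apply: le_trans (_ : _ <= _) (mean_zigzag (Phi := Phi) n mf _ _ _ _) => //.
- apply: le_mean => j _; rewrite /Phi.
  set p := mtransform _ _ _ _; set q := _ - p.
  have -> : f n j = p + q by rewrite /q; lra.
  have := zigzag_ge (l^-1 * p) (l^-1 * q).
  rewrite -(ler_pM2l l0); apply: le_trans.
  rewrite -mulrDr !normrM normfV (gtr0_norm l0) mulrBr mulrA divff ?gt_eqF// mul1r.
  by rewrite [1 < _]ltr_pdivlMl// mulr1.
- move=> p q h; rewrite /Phi -mulrDr mulrCA ler_pM2l//.
  by rewrite [l^-1 * (p + h)]mulrDr [l^-1 * (p - h)]mulrBr zigzag_concave.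
- move=> p q h; rewrite /Phi -mulrDr mulrCA ler_pM2l//.
  by rewrite ![zigzag (l^-1 * p) _]zigzagC [l^-1 * (q + h)]mulrDr
    [l^-1 * (q - h)]mulrBr zigzag_concave.
- move=> p; rewrite /Phi pmulr_rle0// /zigzag !mulr0 normr0 ler01 andbT oppr0 addr0.
  by case: (lerP `|_| 1) => // ?; lra.
- move=> p; rewrite /Phi pmulr_rle0// /zigzag !mulr0 normr0 ler01 mul0r oppr0 add0r.
  by rewrite andTb; case: (lerP `|_| 1) => ? //; lra.
Qed.

Lemma mtransform_L2 f n : dmart f ->
  mean n (fun j => mtransform th f n j ^+ 2) <= mean n (fun j => f n j ^+ 2).
Proof.
move=> mf; rewrite -subr_le0 -meanB.
pose Phi (p q : R) := p ^+ 2 - (p + q) ^+ 2.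
apply: le_trans (_ : _ <= _) (mean_zigzag (Phi := Phi) n mf _ _ _ _) => //.
- apply: le_mean => j _; rewrite /Phi.
  by rewrite [_ + (_ - _)]addrC subrK.
- move=> p q h; rewrite /Phi; lra.
- move=> p q h; rewrite /Phi; nra.
- move=> p; rewrite /Phi; nra.
- move=> p; rewrite /Phi; nra.
Qed.

Lemma mtransform_selfadjoint f w n : dmart f -> dmart w ->
  mean n (fun j => mtransform th f n j * w n j) =
  mean n (fun j => f n j * mtransform th w n j).
Proof.
move=> mf mw; elim: n => [|n ih].
  by rewrite !mean_0 /=; case: (th _); rewrite ?mulr0 ?mul0r.
have H (a b c d : R) : a - b = c - d -> c = d -> a = b by lra.
move: ih; apply: H; rewrite -!meanB mean_pair; apply: eq_mean => j _ /=.
rewrite uphalf_double doubleK (mf n j) (mw n j); case: (th n.+1); lra.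
Qed.

End transform.
End Discrete.

(** * Dyadic intervals, averages and step functions *)

Section Dyadic.
Variable R : realType.
Implicit Types (x y : R -> R) (c : nat -> R) (S : set R).
Notation mu := (@lebesgue_measure R).
Notation U := (@unit_itv R).

Lemma measurable_unit_itv : measurable U.
Proof. exact: measurable_itv. Qed.
#[local] Hint Extern 0 (measurable _) => solve [apply: measurable_unit_itv] : core.

Lemma mu_unit_itv : mu U = 1%:E.
Proof. by rewrite /unit_itv lebesgue_measure_itv/= lte_fin ltr01 oppr0 adde0. Qed.

Lemma mu_unit_itv_lty : (mu U < +oo)%E.
Proof. by rewrite mu_unit_itv ltry. Qed.

Lemma unit_itvP (u : R) : U u <-> 0 < u < 1.
Proof. by rewrite /unit_itv/= in_itv. Qed.

Lemma L1_meas x : in_L1 x -> meas01 x.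
Proof. by move=> /integrableP[/measurable_EFinP]. Qed.

Lemma L1_le x y : meas01 y -> in_L1 x -> (forall u, U u -> `|y u| <= `|x u|) -> in_L1 y.
Proof.
move=> my ix yx; apply: (le_integrable _ _ _ ix) => //.
  exact/measurable_EFinP.
Qed.

Lemma L1_cst (C : R) : in_L1 (cst C).
Proof.
apply: measurable_bounded_integrable => //.
  exact: mu_unit_itv_lty.
exists `|C|; split; rewrite ?num_real// => M CM u _ /=; exact: ltW.
Qed.

Lemma L1_bounded y (C : R) : meas01 y -> (forall u, U u -> `|y u| <= C) -> in_L1 y.
Proof.
move=> my yC; apply: (L1_le my (L1_cst C)) => u Uu /=.
by apply: le_trans (yC u Uu) (ler_norm _).
Qed.

Lemma L1D x y : in_L1 x -> in_L1 y -> in_L1 (fun u => x u + y u).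
Proof. by move=> ix iy; exact: (integrableD _ ix iy). Qed.

Lemma L1B x y : in_L1 x -> in_L1 y -> in_L1 (fun u => x u - y u).
Proof. by move=> ix iy; exact: (integrableB _ ix iy). Qed.

Lemma L1Z (a : R) x : in_L1 x -> in_L1 (fun u => a * x u).
Proof. by move=> ix; exact: (integrableZl _ a ix). Qed.

Lemma L1_norm x : in_L1 x -> in_L1 (fun u => `|x u|).
Proof. by move=> ix; exact: (integrable_norm ix). Qed.

Lemma L1_mul x y (C : R) : in_L1 x -> meas01 y -> (forall u, U u -> `|y u| <= C) ->
  in_L1 (fun u => x u * y u).
Proof.
move=> ix my yC; apply: (@L1_le (fun u => C * x u)); last 1 first.
- move=> u Uu; rewrite !normrM mulrC ler_wpM2r//.
  by apply: le_trans (yC u Uu) (ler_norm _).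
- by apply: measurable_funM => //; exact: L1_meas.
- exact: L1Z.
Qed.

Lemma L1_sub x S : in_L1 x -> measurable S -> S `<=` U ->
  mu.-integrable S (EFin \o x).
Proof. by move=> ix mS SU; apply: integrableS ix. Qed.

(** The integral over the unit interval. *)
Definition int01 x : R := Rintegral mu U x.

Lemma int01_eq x y : (forall u, U u -> x u = y u) -> int01 x = int01 y.
Proof. by move=> xy; apply: eq_Rintegral => u; rewrite inE; exact: xy. Qed.

Lemma int01D x y : in_L1 x -> in_L1 y -> int01 (fun u => x u + y u) = int01 x + int01 y.
Proof. by move=> ix iy; rewrite /int01 RintegralD//; exact: measurable_unit_itv. Qed.

Lemma int01Z (a : R) x : in_L1 x -> int01 (fun u => a * x u) = a * int01 x.
Proof. by move=> ix; rewrite /int01 RintegralZl//; exact: measurable_unit_itv. Qed.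

Lemma int01_le x y : in_L1 x -> in_L1 y -> (forall u, U u -> x u <= y u) ->
  int01 x <= int01 y.
Proof. by move=> ix iy xy; apply: le_Rintegral => //; exact: measurable_unit_itv. Qed.

Lemma int01_ge0 x : (forall u, U u -> 0 <= x u) -> 0 <= int01 x.
Proof. by move=> x0; apply: Rintegral_ge0. Qed.

Lemma int01_norm x : in_L1 x -> `|int01 x| <= int01 (fun u => `|x u|).
Proof. by move=> ix; apply: le_normr_Rintegral => //; exact: measurable_unit_itv. Qed.

(** The j-th dyadic interval of level n; the one with j = 0 lacks its left end
    point 0, which is not in the unit interval. *)
Definition dyad n j : set R := U `&` [set u | Num.truncn (2 ^+ n * u) = j].

Lemma truncn_half n (u : R) : 0 <= u ->
  Num.truncn (2 ^+ n * u) = (Num.truncn (2 ^+ n.+1 * u))./2.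
Proof.
move=> u0; apply: truncn_def.
have /truncn_itv/andP[] : 0 <= 2 ^+ n.+1 * u by rewrite mulr_ge0// exprn_ge0.
set k := Num.truncn _; move: (odd_double_half k); set h := k./2 => kE.
have : (h.*2 <= k)%N by rewrite -kE leq_addl.
have : (k.+1 <= h.+1.*2)%N by rewrite -{1}kE doubleS; case: (odd k).
rewrite -!(ler_nat R) -!muln2 !natrM exprS.
move: (2 ^+ n) (k%:R) (h%:R) (k.+1%:R) (h.+1%:R) => a b c d e; nra.
Qed.

Lemma truncn_lt n (u : R) : U u -> (Num.truncn (2 ^+ n * u) < 2 ^ n)%N.
Proof.
move=> /unit_itvP /andP[u0 u1]; rewrite truncn_lt_nat ?mulr_ge0 ?exprn_ge0 ?(ltW u0)//.
by rewrite natrX -[ltRHS]mulr1 ltr_pM2l ?exprn_gt0.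
Qed.

Lemma dyad_itv n j : dyad n j = U `&` [set` `[j%:R / 2 ^+ n, j.+1%:R / 2 ^+ n[%R].
Proof.
apply/seteqP; split => u [Uu /= H]; split => //; move: (Uu) => /unit_itvP/andP[u0 _];
  have nu : 0 <= 2 ^+ n * u by rewrite mulr_ge0 ?exprn_ge0 ?ltW.
  by rewrite /= in_itv/= ler_pdivrMr ?exprn_gt0// ltr_pdivlMr ?exprn_gt0//
      mulrC -H truncn_itv.
apply: truncn_def.
by move: H; rewrite in_itv/= ler_pdivrMr ?exprn_gt0// ltr_pdivlMr ?exprn_gt0// mulrC.
Qed.

Lemma measurable_dyad n j : measurable (dyad n j).
Proof. by rewrite dyad_itv; apply: measurableI. Qed.
#[local] Hint Extern 0 (measurable _) => solve [apply: measurable_dyad] : core.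

Lemma dyad_sub_unit n j : dyad n j `<=` U. Proof. by move=> u []. Qed.

Lemma mu_dyad n j : (j < 2 ^ n)%N -> mu (dyad n j) = (2^-1 ^+ n)%:E.
Proof.
move=> jn; have p2 : 0 < 2 ^+ n :> R by rewrite exprn_gt0.
have j1 : j.+1%:R / 2 ^+ n <= 1 :> R.
  by rewrite ler_pdivrMr// mul1r -natrX ler_nat.
have H : mu (`]j%:R / 2 ^+ n, j.+1%:R / 2 ^+ n[%classic : set R) = (2^-1 ^+ n)%:E.
  rewrite lebesgue_measure_itv/= lte_fin ltr_pM2r ?invr_gt0// ltr_nat leqnn.
  by rewrite -EFinB -mulrBl -natrB// subSnn mul1r exprVn.
apply/eqP; rewrite eq_le; apply/andP; split.
  have <- : mu (`[j%:R / 2 ^+ n, j.+1%:R / 2 ^+ n[%classic : set R) = (2^-1 ^+ n)%:E.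
    rewrite -H !lebesgue_measure_itv//.
  by rewrite dyad_itv; apply: le_measure; rewrite ?inE//; apply: measurableI.
rewrite -H dyad_itv; apply: le_measure; rewrite ?inE//; first exact: measurableI.
move=> u /=; rewrite in_itv/= => /andP[u1 u2]; split; last by rewrite /= in_itv/= (ltW u1).
apply/unit_itvP; rewrite (lt_le_trans u2)// andbT (le_lt_trans _ u1)// divr_ge0.
Qed.

Lemma dyad_split n j : dyad n j = dyad n.+1 j.*2 `|` dyad n.+1 j.*2.+1.
Proof.
apply/seteqP; split => u.
  move=> [Uu /= H]; have /unit_itvP/andP[/ltW u0 _] := Uu.
  move: H; rewrite truncn_half// => H.
  have := odd_double_half (Num.truncn (2 ^+ n.+1 * u)); rewrite H.
  by case: odd => /= E; [right|left]; split => //=; rewrite -E ?add1n ?add0n.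
move=> [] [Uu /= H]; split => //=; have /unit_itvP/andP[/ltW u0 _] := Uu.
  by rewrite truncn_half// H doubleK.
by rewrite truncn_half// H /= uphalf_double.
Qed.

Lemma dyad00 : dyad 0 0 = U.
Proof.
apply/seteqP; split => u; first by case.
move=> Uu; split => //=; have := truncn_lt 0 Uu; rewrite expn0 ltnS leqn0.
by move/eqP.
Qed.

Lemma Rintegral_dyad_split x n j : in_L1 x ->
  Rintegral mu (dyad n j) x =
  Rintegral mu (dyad n.+1 j.*2) x + Rintegral mu (dyad n.+1 j.*2.+1) x.
Proof.
move=> ix; rewrite dyad_split Rintegral_setU// -?dyad_split.
  exact: L1_sub (@dyad_sub_unit _ _).
apply/disj_setPS => u [[_ E1] [_ E2]]; move: E1 E2 => /= -> /eqP.
by rewrite -addn1 -[X in X == _]addn0 eqn_add2l.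
Qed.

Lemma int01_dyad x n : in_L1 x ->
  int01 x = \sum_(j < 2 ^ n) Rintegral mu (dyad n j) x.
Proof.
move=> ix; elim: n => [|n ->].
  by rewrite expn0 big_ord1 dyad00.
by rewrite expnS mul2n (sum_double _ (fun j => Rintegral mu (dyad n.+1 j) x));
  apply: eq_bigr => j _; exact: Rintegral_dyad_split.
Qed.

(** The average of x over a dyadic interval. *)
Definition avg x n j : R := 2 ^+ n * Rintegral mu (dyad n j) x.

Lemma avg_dmart x : in_L1 x -> dmart (avg x).
Proof.
by move=> ix n j; rewrite /avg Rintegral_dyad_split// exprS; lra.
Qed.

Lemma avgD x y n j : in_L1 x -> in_L1 y ->
  avg (fun u => x u + y u) n j = avg x n j + avg y n j.
Proof.
move=> ix iy; rewrite /avg RintegralD// ?mulrDr//; exact: L1_sub (@dyad_sub_unit _ _).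
Qed.

Lemma avgZ a x n j : in_L1 x -> avg (fun u => a * x u) n j = a * avg x n j.
Proof.
move=> ix; rewrite /avg RintegralZl// 1?mulrCA//; exact: L1_sub (@dyad_sub_unit _ _).
Qed.

(** The step function with value c j on the j-th interval of level n. *)
Definition step n c : R -> R := fun u => c (Num.truncn (2 ^+ n * u)).

Lemma measurable_truncn_set n (P : set nat) :
  measurable (U `&` [set u | P (Num.truncn (2 ^+ n * u))]).
Proof.
rewrite (_ : _ `&` _ = \bigcup_(j in P) dyad n j).
  by apply: bigcup_measurable => j _; exact: measurable_dyad.
apply/seteqP; split => u; first by move=> [Uu Pu]; exists (Num.truncn (2 ^+ n * u)).
by move=> [j Pj [Uu /= H]]; split => //=; rewrite H.
Qed.

Lemma meas_step n c : meas01 (step n c).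
Proof. by move=> _ Y mY; exact: (measurable_truncn_set n (c @^-1` Y)). Qed.

Lemma step_bounded n c : exists C, forall u, U u -> `|step n c u| <= C.
Proof.
exists (\sum_(j < 2 ^ n) `|c j|) => u Uu.
rewrite /step (bigD1 (Ordinal (truncn_lt n Uu)))//= lerDl.
exact: sumr_ge0.
Qed.

Lemma L1_step n c : in_L1 (step n c).
Proof. by have [C HC] := step_bounded n c; exact: L1_bounded (meas_step n c) HC. Qed.

Lemma L1_mul_step x n c : in_L1 x -> in_L1 (fun u => x u * step n c u).
Proof. by move=> ix; have [C HC] := step_bounded n c;
    exact: L1_mul ix (meas_step n c) HC. Qed.

Lemma int01_mul_step x n c : in_L1 x ->
  int01 (fun u => x u * step n c u) = mean n (fun j => avg x n j * c j).
Proof.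
move=> ix; rewrite (@int01_dyad _ n); last exact: L1_mul_step.
rewrite /mean mulr_sumr; apply: eq_bigr => j _.
rewrite /avg !mulrA -exprMn mulVf ?expr1n ?mul1r ?pnatr_eq0//.
rewrite -RintegralZr//; last exact: L1_sub (@dyad_sub_unit _ _).
by apply: eq_Rintegral => u; rewrite inE => -[_ /= H]; rewrite /step H.
Qed.

Lemma avg_cst (a : R) n j : (j < 2 ^ n)%N -> avg (cst a) n j = a.
Proof.
move=> jn; rewrite /avg Rintegral_cst// (congr1 fine (mu_dyad jn))/=
    mulrCA -exprMn divff ?expr1n ?mulr1//.
Qed.

Lemma int01_step n c : int01 (step n c) = mean n c.
Proof.
have := @int01_mul_step (cst 1) n c (L1_cst 1).
rewrite (@int01_eq _ (step n c)); last by move=> u _; rewrite mul1r.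
by move=> ->; apply: eq_mean => j jn; rewrite avg_cst// mul1r.
Qed.

Lemma mean_avg_norm x n : in_L1 x ->
  mean n (fun j => `|avg x n j|) <= int01 (fun u => `|x u|).
Proof.
move=> ix; rewrite (@int01_dyad _ n); last exact: L1_norm.
rewrite /mean mulr_sumr; apply: ler_sum => j _.
rewrite /avg normrM ger0_norm ?exprn_ge0// mulrA -exprMn mulVf ?expr1n ?mul1r ?pnatr_eq0//.
apply: le_normr_Rintegral => //; exact: L1_sub (@dyad_sub_unit _ _).
Qed.

(** The measure of the part of S in the unit interval. *)
Definition msr S : R := fine (mu (U `&` S)).

(** The part of S in the unit interval is measurable. *)
Definition ms01 S : Prop := measurable (U `&` S).

Lemma mu_fin S : ms01 S -> mu (U `&` S) = (msr S)%:E.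
Proof.
move=> mS; rewrite /msr fineK//.
rewrite ge0_fin_numE ?measure_ge0//; apply: le_lt_trans mu_unit_itv_lty.
by apply: le_measure; rewrite ?inE//; exact: measurable_unit_itv.
Qed.

Lemma msr_ge0 S : 0 <= msr S. Proof. by rewrite fine_ge0. Qed.

Lemma msr_le S S' : ms01 S -> ms01 S' -> (forall u, U u -> S u -> S' u) ->
  msr S <= msr S'.
Proof.
move=> mS mS' SS; rewrite -lee_fin -!mu_fin//; apply: le_measure; rewrite ?inE//.
by move=> u [Uu /SS]; split => //; auto.
Qed.

Lemma msr_le1 S : ms01 S -> msr S <= 1.
Proof.
move=> mS; rewrite -lee_fin -mu_fin// -mu_unit_itv; apply: le_measure; rewrite ?inE//.
Qed.

Lemma ms01_or S S' : ms01 S -> ms01 S' -> ms01 (fun u => S u \/ S' u).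
Proof. by move=> mS mS'; rewrite /ms01 setIUr; exact: measurableU. Qed.

Lemma msr_or S S' : ms01 S -> ms01 S' ->
  msr (fun u => S u \/ S' u) <= msr S + msr S'.
Proof.
move=> mS mS'; rewrite -lee_fin EFinD -!mu_fin//; last exact: ms01_or.
by rewrite (_ : _ `&` _ = (U `&` S) `|` (U `&` S')) ?setIUr//; exact: measureU2.
Qed.

Lemma msr_eq S S' : (forall u, U u -> S u <-> S' u) -> msr S = msr S'.
Proof.
move=> SS; congr (fine (mu _)); apply/seteqP.
by split => u [Uu /(SS _ Uu)].
Qed.

Lemma meas_gt x l : meas01 x -> ms01 [set u | l < x u].
Proof.
move=> mx; have := mx measurable_unit_itv _ (measurable_itv `]l, +oo[).
by rewrite /ms01; congr measurable; apply/seteqP; split => u [Uu] /=;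
    rewrite in_itv/= andbT.
Qed.

Lemma meas_norm x : meas01 x -> meas01 (fun u => `|x u|).
Proof. by move=> mx; apply: measurableT_comp. Qed.

Lemma meas_ngt x l : meas01 x -> ms01 [set u | l < `|x u|].
Proof. by move=> mx; apply: meas_gt; exact: meas_norm. Qed.

Lemma meas_indic S : ms01 S -> meas01 (\1_S).
Proof.
move=> mS; apply: (eq_measurable_fun (\1_(U `&` S) : R -> R)) => [u Uu|].
  by rewrite !indicE in_setI Uu.
exact: measurable_indic.
Qed.

Lemma indic_le1 S u : `|\1_S u : R| <= 1.
Proof. by rewrite indicE; case: (_ \in _); rewrite ?normr1 ?normr0. Qed.

Lemma L1_indic S : ms01 S -> in_L1 (\1_S).
Proof.
by move=> mS; apply: (L1_bounded (meas_indic mS)) => u _; exact: indic_le1.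
Qed.

Lemma L1_mul_indic x S : in_L1 x -> ms01 S -> in_L1 (fun u => x u * \1_S u).
Proof.
by move=> ix mS; apply: (L1_mul ix (meas_indic mS)) => u _; exact: indic_le1.
Qed.

Lemma int01_indic S : ms01 S -> int01 (\1_S) = msr S.
Proof.
move=> mS; rewrite (@int01_eq _ (\1_(U `&` S))); last first.
  by move=> u Uu; rewrite !indicE in_setI (mem_set Uu).
by rewrite /int01 /Rintegral integral_indic// /msr setIAC setIid.
Qed.

Lemma msr_step n (P : pred R) c :
  msr [set u | P (step n c u)] = mean n (fun j => (P (c j))%:R).
Proof.
rewrite -int01_step -int01_indic; last exact: (measurable_truncn_set n [set j | P (c j)]).
apply: int01_eq => u _; rewrite indicE /step; congr (_%:R); congr nat_of_bool.
by apply/idP/idP; rewrite inE.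
Qed.

End Dyadic.

(** * Distribution functions and decreasing rearrangements *)

Section Rearr.
Variable R : realType.
Implicit Types (x y : R -> R) (S : set R) (s t : R).
Notation mu := (@lebesgue_measure R).
Notation U := (@unit_itv R).
#[local] Hint Extern 0 (measurable _) => solve [apply: measurable_unit_itv] : core.

(** The layer cake formula, from the tail formula for the expectation under
    the uniform law. *)
Lemma integral_ccdf x : meas01 x -> (forall u, U u -> 0 <= x u) ->
  (\int[mu]_(u in U) (x u)%:E = \int[mu]_(r in `[0%R, +oo[)
      mu (U `&` [set u | r < x u]%R))%E.
Proof.
move=> mx x0; pose f : R -> R := x \_ U.
have mf : measurable_fun setT f by apply/(measurable_restrictT x (@measurable_unit_itv R)).
have f0 u : 0 <= f u.
  rewrite /f patchE; case: ifPn => //; rewrite inE; exact: x0.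
pose P := @uniform_prob R 0 1 ltr01.
(* The uniform law on [0, 1] is Lebesgue measure restricted to [0, 1]. *)
have PE A : measurable A -> P A = mu (A `&` `[0, 1]).
  move=> mA; have := @integral_uniform R 0 1 ltr01 (fun u => (\1_A u)%:E).
  rewrite subr0 invr1 mul1e !integral_indic// setIT; apply.
    by apply/measurable_EFinP/measurable_indic.
  by move=> u; rewrite lee_fin.
have h := isMeasurableFun.Build _ _ (g_sigma_algebraType R.-ocitv.-measurable) R f mf.
pose X : {RV P >-> R} := HB.pack (f : g_sigma_algebraType R.-ocitv.-measurable -> R) h.
have := @ge0_expectation_ccdf _ _ R P X f0.
rewrite expectation_def integral_uniform//; last first.
  by apply/measurable_EFinP.
rewrite subr0 invr1 mul1e => H.
transitivity (\int[mu]_(u in `[0%R, 1%R]) (f u)%:E)%E.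
  rewrite integral_mkcond [RHS]integral_mkcond; apply: eq_integral => u _.
  rewrite !patchE /f patchE; case: ifPn => uU.
    by rewrite ifT//; move: uU; rewrite !inE => /unit_itvP /andP[/ltW + /ltW];
        rewrite /= in_itv/= => -> ->.
  by case: ifPn.
transitivity (\int[mu]_(r in `[0%R, +oo[) ccdf X r)%E; first exact: H.
apply: eq_integral => r; rewrite inE/= in_itv/= andbT => r0.
transitivity (P (f @^-1` `]r, +oo[)); first by [].
rewrite PE; last first.
  rewrite -[X in measurable X]setTI; apply: mf => //; exact: measurable_itv.
congr mu; apply/seteqP; split => u /=; rewrite !in_itv/= andbT /f patchE.
  move=> []; case: ifPn; first by rewrite inE.
  by move=> _ /lt_le_trans /(_ r0); rewrite ltxx.
move=> [Uu]; rewrite mem_set// => ru; split=> //.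
by move: Uu => /unit_itvP /andP[/ltW -> /ltW ->].
Qed.

(** The set where |x| exceeds s. *)
Definition dset x s : set R := [set u | s < `|x u|].
(** The distribution function of x. *)
Definition dist x s : R := msr (dset x s).

Lemma ms01_dset x s : meas01 x -> ms01 (dset x s).
Proof. exact: meas_ngt. Qed.

Lemma mu_dset x s t : meas01 x ->
  (mu [set u | U u /\ (s < `|x u|)%R] <= t%:E)%E = (dist x s <= t).
Proof. by move=> mx; rewrite -lee_fin -mu_fin//; exact: ms01_dset. Qed.

Lemma dist_ge0 x s : 0 <= dist x s. Proof. exact: msr_ge0. Qed.

Lemma dist_le1 x s : meas01 x -> dist x s <= 1.
Proof. by move=> mx; apply: msr_le1; exact: ms01_dset. Qed.

Lemma dist_le x s s' : meas01 x -> s <= s' -> dist x s' <= dist x s.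
Proof.
move=> mx ss; apply: msr_le; try exact: ms01_dset.
by move=> u _; exact: le_lt_trans.
Qed.

Lemma rearr_le x s t : meas01 x -> 0 <= s -> dist x s <= t -> rearr x t <= s.
Proof.
move=> mx s0 st; apply: ge_inf; last by split; rewrite ?mu_dset.
by exists 0 => r [].
Qed.

(** The distribution function tends to 0, so the set defining [rearr x t] is
    nonempty. *)
Lemma dist_small x t : meas01 x -> 0 < t -> exists2 s, 0 <= s & dist x s <= t.
Proof.
move=> mx t0; pose F (n : nat) := U `&` dset x n%:R.
have mF n : measurable (F n) by exact: ms01_dset.
have F0 : \bigcap_n F n = set0.
  apply/seteqP; split => // u Fu.
  have [_] := Fu (Num.truncn `|x u|).+1 I.
  rewrite /dset/= ltNge => /negP; apply; apply: ltW; exact: truncnS_gt.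
have niF : nonincreasing_seq F.
  move=> m n mn; apply/subsetPset => u [Uu H]; split=> //.
  by apply: le_lt_trans H; rewrite ler_nat.
apply: contrapT => /forall2NP H.
have Ht n : (t%:E <= mu (F n))%E.
  rewrite /F mu_fin; last exact: ms01_dset.
  by rewrite lee_fin; case: (H n%:R) => // /negP; rewrite -ltNge => /ltW.
have cF : mu \o F @ \oo --> 0%E.
  rewrite -(measure0 mu) -F0; apply: nonincreasing_cvg_mu => //.
    by rewrite [ltLHS]mu_fin ?ltry//; exact: ms01_dset.
  by rewrite F0.
have : (t%:E <= 0%R%:E)%E by apply: cvge_to_ge cF _; exact: nearW.
by rewrite lee_fin leNgt t0.
Qed.

Lemma rearr_ge0 x t : meas01 x -> 0 < t -> 0 <= rearr x t.
Proof.
move=> mx t0; have [s s0 st] := dist_small mx t0.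
apply: lb_le_inf; last by move=> r [].
by exists s; split => //; rewrite mu_dset.
Qed.

Lemma rearr_gt x s t : meas01 x -> 0 < t -> rearr x t < s -> dist x s <= t.
Proof.
move=> mx t0 rs; have [s1 s10 st1] := dist_small mx t0.
have [|r [r0]] := @inf_lt R [set s : R | 0 <= s /\
    (mu [set u | unit_itv u /\ (s < `|x u|)%R] <= t%:E)%E] s _ rs.
  by exists s1; split => //; rewrite mu_dset.
by rewrite mu_dset// => rt rs'; apply: le_trans rt; apply: dist_le => //; exact: ltW.
Qed.

Lemma dist_rearr x t : meas01 x -> 0 < t -> dist x (rearr x t) <= t.
Proof.
move=> mx t0; set r := rearr x t.
pose F (n : nat) := U `&` dset x (r + n.+1%:R^-1).
have mF n : measurable (F n) by exact: ms01_dset.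
have FE : \bigcup_n F n = U `&` dset x r.
  apply/seteqP; split => u.
    move=> [n _ [Uu]]; rewrite /dset/= => H; split=> //=; apply: lt_trans H.
    by rewrite ltrDl invr_gt0.
  move=> [Uu]; rewrite /dset/= -subr_gt0 => H.
  exists (Num.truncn (`|x u| - r)^-1) => //; split=> //; rewrite /dset/= -ltrBrDl.
  by rewrite invf_plt ?posrE// truncnS_gt.
have ndF : nondecreasing_seq F.
  move=> m n mn; apply/subsetPset => u [Uu H]; split=> //.
  by apply: le_lt_trans H; rewrite lerD2l lef_pV2 ?posrE// ler_nat.
have cF : mu \o F @ \oo --> mu (U `&` dset x r).
  by rewrite -FE; apply: nondecreasing_cvg_mu => //; rewrite FE; exact: ms01_dset.
rewrite -lee_fin -[leLHS]mu_fin; last exact: ms01_dset.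
apply: (cvge_to_le cF); apply: nearW => n.
rewrite /= mu_fin ?lee_fin; last exact: ms01_dset.
by apply: rearr_gt => //; rewrite ltrDl invr_gt0.
Qed.

(** [rearr x] is the generalized inverse of [dist x]. *)
Lemma lt_rearr x s t : meas01 x -> 0 <= s -> 0 < t -> (s < rearr x t) = (t < dist x s).
Proof.
move=> mx s0 t0; rewrite !ltNge; congr (~~ _); apply/idP/idP => H.
  by apply: le_trans (dist_rearr mx t0); exact: dist_le.
exact: rearr_le.
Qed.

Lemma rearr_mono x y t : meas01 x -> meas01 y -> 0 < t ->
  (forall s, 0 <= s -> dist x s <= dist y s) -> rearr x t <= rearr y t.
Proof.
move=> mx my t0 H; apply: rearr_le => //; first exact: rearr_ge0.
by apply: le_trans (H _ _) (dist_rearr my t0); exact: rearr_ge0.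
Qed.

Lemma rearr_nincr x s t : meas01 x -> 0 < s -> s <= t -> rearr x t <= rearr x s.
Proof.
move=> mx s0 st; apply: rearr_le => //; first exact: rearr_ge0.
by apply: le_trans st; exact: dist_rearr.
Qed.

Lemma rearr_ge1 x t : meas01 x -> 1 <= t -> rearr x t = 0.
Proof.
move=> mx t1; apply/eqP; rewrite eq_le rearr_ge0 ?(lt_le_trans _ t1)// andbT.
by apply: rearr_le => //; apply: le_trans t1; exact: dist_le1.
Qed.

Lemma distZ (a : R) x s : 0 < a -> dist (a \*o x) (a * s) = dist x s.
Proof.
move=> a0; apply: msr_eq => u _; rewrite /dset/= normrM (gtr0_norm a0).
by rewrite ltr_pM2l.
Qed.

Lemma measZ (a : R) x : meas01 x -> meas01 (a \*o x).
Proof. by move=> mx; exact: measurable_funM. Qed.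

Lemma rearrZ (a : R) x t : meas01 x -> 0 < a -> 0 < t -> rearr (a \*o x) t = a * rearr x t.
Proof.
move=> mx a0 t0; apply/eqP; rewrite eq_le; apply/andP; split.
  apply: rearr_le; [exact: measZ|by rewrite mulr_ge0 ?rearr_ge0// ltW|].
  by rewrite distZ// dist_rearr.
rewrite mulrC -ler_pdivlMr//; apply: rearr_le => //.
  by rewrite divr_ge0 ?(ltW a0)// rearr_ge0//; exact: measZ.
rewrite -(distZ _ _ a0) mulrCA divff ?gt_eqF// mulr1.
by rewrite dist_rearr//; exact: measZ.
Qed.

Lemma meas_rearr x : meas01 x -> meas01 (rearr x).
Proof.
move=> mx; apply: (measurability (@RGenOInfty.G R)) => [|/= _ [_] [r] -> <-].
- exact: RGenOInfty.measurableE.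
have [r0|r0] := leP 0 r.
  rewrite (_ : _ `&` _ = U `&` [set` `]-oo, dist x r[%R]); first exact: measurableI.
  apply/seteqP; split => u [/[dup] Uu /unit_itvP/andP[u0 _]];
      rewrite /= !in_itv/= andbT lt_rearr//.
rewrite (_ : _ `&` _ = U)//; apply/seteqP;
    split => [u []//|u /[dup] Uu /unit_itvP/andP[u0 _]].
by split=> //=; rewrite in_itv/= andbT (lt_le_trans r0)// rearr_ge0.
Qed.

Lemma dist_rearrE x s : meas01 x -> 0 <= s -> dist (rearr x) s = dist x s.
Proof.
move=> mx s0; transitivity (msr [set u | u < dist x s]).
  apply: msr_eq => u /unit_itvP/andP[u0 _]; rewrite /dset/= ger0_norm ?rearr_ge0//.
  by rewrite lt_rearr.
rewrite /msr (_ : _ `&` _ = `]0, dist x s[%classic); last first.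
  apply/seteqP; split => u; rewrite /= in_itv/=.
    by move=> [/unit_itvP/andP[-> _] ->].
  move=> /andP[u0 ud]; split=> //; apply/unit_itvP; rewrite u0/=.
  by rewrite (lt_le_trans ud)// dist_le1.
rewrite lebesgue_measure_itv/= lte_fin; case: ltP => H; first by rewrite oppr0 addr0.
by apply/eqP; rewrite eq_le H dist_ge0.
Qed.

(** A function and its rearrangement have the same distribution function. *)
Lemma integral_rearr x : meas01 x ->
  (\int[mu]_(u in U) (rearr x u)%:E = \int[mu]_(u in U) (`|x u|)%:E)%E.
Proof.
move=> mx; rewrite !integral_ccdf//; last 3 first.
- exact: meas_norm.
- exact: meas_rearr.
- by move=> u /unit_itvP/andP[u0 _]; exact: rearr_ge0.
apply: eq_integral => s; rewrite inE/= in_itv/= andbT => s0.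
rewrite mu_fin; last by apply: meas_gt; exact: meas_rearr.
rewrite [RHS]mu_fin; last exact: ms01_dset.
congr (_%:E); rewrite -[RHS]/(dist x s) -(dist_rearrE mx s0).
by apply: msr_eq => u /unit_itvP/andP[u0 _]; rewrite /dset/= ger0_norm// rearr_ge0.
Qed.

Lemma L1_rearr x : in_L1 x -> in_L1 (rearr x).
Proof.
move=> ix; have mx := L1_meas ix; apply/integrableP; split.
  by apply/measurable_EFinP; exact: meas_rearr.
have /integrableP[_] := ix; congr (_ < _)%E; rewrite -[LHS]integral_rearr//.
apply: eq_integral => u; rewrite inE => /unit_itvP/andP[u0 _].
by rewrite /= ger0_norm// rearr_ge0.
Qed.

Lemma int01_rearr x : meas01 x -> int01 (rearr x) = int01 (fun u => `|x u|).
Proof. by move=> mx; rewrite /int01 /Rintegral integral_rearr. Qed.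

Lemma Rintegral_subE x S : measurable S -> S `<=` U ->
  Rintegral mu S x = int01 (fun u => x u * \1_S u).
Proof.
move=> mS SU; rewrite -{1}(setIidr SU) Rintegral_mkcondr; apply: int01_eq => u _.
by rewrite patchE indicE; case: ifPn => _; rewrite ?mulr1 ?mulr0.
Qed.

(** The part of x where |x| exceeds s. *)
Definition above x s : R -> R := fun u => x u * \1_(dset x s) u.

Lemma aboveE x s u : above x s u = if s < `|x u| then x u else 0.
Proof.
rewrite /above indicE; case: ifPn => H.
  by rewrite mem_set ?mulr1.
by rewrite memNset ?mulr0//; exact/negP.
Qed.

Lemma int01_above_le x t : in_L1 x -> 0 < t < 1 ->
  int01 (fun u => `|above x (rearr x t) u|) <= Rintegral mu `]0, t[ (rearr x).
Proof.
move=> ix /andP[t0 t1]; have mx := L1_meas ix.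
have ix1 : in_L1 (above x (rearr x t)) by apply: L1_mul_indic => //; exact: ms01_dset.
have mx1 := L1_meas ix1.
have tU : `]0, t[ `<=` U.
  move=> u /=; rewrite in_itv/= => /andP[u0 ut]; apply/unit_itvP.
  by rewrite u0 (lt_trans ut).
have mt : ms01 `]0, t[ by apply: measurableI => //; exact: measurable_itv.
rewrite -int01_rearr// Rintegral_subE//; apply: int01_le.
- exact: L1_rearr.
- by apply: L1_mul_indic => //; exact: L1_rearr.
move=> u /unit_itvP/andP[u0 u1]; rewrite indicE; case: (ltP u t) => ut.
  rewrite mem_set ?mulr1/= ?in_itv/= ?u0//.
  apply: rearr_mono => // s s0; apply: msr_le; try exact: ms01_dset.
  by move=> v _; rewrite /dset/= aboveE; case: ifP => // _; rewrite normr0 ltNge s0.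
rewrite memNset ?mulr0/= ?in_itv/= ?u0 -?leNgt//; last by rewrite ltNge ut.
apply: rearr_le => //; apply: le_trans (_ : dist x (rearr x t) <= _).
  apply: msr_le; try exact: ms01_dset.
  by move=> v _; rewrite /dset/= aboveE; case: ifP => // _; rewrite normr0 ltxx.
by apply: le_trans ut; exact: dist_rearr.
Qed.

End Rearr.

(** * The Calderon bound for finite transforms *)

Section Main.
Variable R : realType.
Implicit Types (x y : R -> R) (S : set R) (s t : R).
Notation mu := (@lebesgue_measure R).
Notation U := (@unit_itv R).
#[local] Hint Extern 0 (measurable _) => solve [apply: measurable_unit_itv] : core.
Variable th : nat -> bool.

(** The transform truncated at level n, that is T (E_n x); it is a step function
    of level n. *)
Definition Tn n x : R -> R := step n (mtransform th (avg x) n).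

Lemma meas_Tn n x : meas01 (Tn n x).
Proof. exact: meas_step. Qed.

Lemma dist_step n (c : nat -> R) l : dist (step n c) l =
    mean n (fun j => (l < `|c j|)%R%:R).
Proof. exact: (msr_step n (fun v => l < `|v|) c). Qed.

Lemma Tn_weak n x l : in_L1 x -> 0 < l -> l * dist (Tn n x) l <= int01 (fun u => `|x u|).
Proof.
move=> ix l0; rewrite dist_step; apply: le_trans (mean_avg_norm n ix).
by apply: mtransform_weak => //; exact: avg_dmart.
Qed.

Lemma TnD n x y u : in_L1 x -> in_L1 y ->
  Tn n (fun u => x u + y u) u = Tn n x u + Tn n y u.
Proof.
move=> ix iy; rewrite /Tn /step -mtransformD; congr mtransform.
by apply/funext => m; apply/funext => j; exact: avgD.
Qed.

Lemma TnZ n (a : R) x u : in_L1 x -> Tn n (fun u => a * x u) u = a * Tn n x u.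
Proof.
move=> ix; rewrite /Tn /step -mtransformZ; congr mtransform.
by apply/funext => m; apply/funext => j; exact: avgZ.
Qed.

Lemma avg_step n (c : nat -> R) j : (j < 2 ^ n)%N -> avg (step n c) n j = c j.
Proof.
move=> jn; rewrite /avg (@eq_Rintegral _ _ _ _ _ (cst (c j))).
  exact: (avg_cst (c j) jn).
by move=> u; rewrite inE => -[_ /= H]; rewrite /step H.
Qed.

(** A pointwise bound adapted to functions v that satisfy an L_2 and a weak
    L_1 estimate: v ^+ 2 handles v > 1, the sum handles 2^-m < v <= 1. *)
Lemma le_sum_levels_sqr (v : R) m : 0 <= v ->
  v <= v ^+ 2 + (\sum_(i < m) 2^-1 ^+ i * (2^-1 ^+ i.+1 < v)%R%:R + 2^-1 ^+ m).
Proof.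
move=> v0; elim: m => [|m ih]; first by rewrite big_ord0 expr0; nra.
have S0 : 0 <= \sum_(i < m) 2^-1 ^+ i * (2^-1 ^+ i.+1 < v)%R%:R :> R.
  by apply: sumr_ge0 => i _; rewrite mulr_ge0 ?exprn_ge0.
rewrite big_ord_recr/=; move: ih S0; set S := \sum_(_ < _) _.
have -> : 2^-1 ^+ m = 2 * 2^-1 ^+ m.+1 :> R by rewrite exprS; lra.
have : 0 < 2^-1 ^+ m.+1 :> R by rewrite exprn_gt0.
move: (_ ^+ m.+1) => b b0 ih S0; have := sqr_ge0 v.
by case: (ltP b v) => bv /= v2; rewrite ?mulr1 ?mulr0; lra.
Qed.

(** The layer cake of v over finitely many decreasing levels a k. *)
Lemma le_sum_levels (a : nat -> R) (v : R) K : (forall k, a k.+1 <= a k) -> v <= a 0%N ->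
  v <= \sum_(k < K) (a k - a k.+1) * (a k.+1 < v)%R%:R + a K.
Proof.
move=> na va; elim: K => [|K ih]; first by rewrite big_ord0 add0r.
have S0 : 0 <= \sum_(i < K) (a i - a i.+1) * (a i.+1 < v)%R%:R.
  by apply: sumr_ge0 => i _; rewrite mulr_ge0// subr_ge0.
rewrite big_ord_recr/=; move: ih S0 (na K); set S := \sum_(_ < _) _.
by case: ltP => /=; lra.
Qed.

Lemma sum_levels_by_parts (a : nat -> R) K :
  \sum_(k < K.+1) (a k - a k.+1) * (2 * k%:R + 5) =
  5 * a 0%N + 2 * \sum_(k < K) a k.+1 - (2 * K%:R + 5) * a K.+1.
Proof.
elim: K => [|K ih]; first by rewrite big_ord1 big_ord0/= ?(mulr0, add0r, addr0); lra.
by rewrite big_ord_recr/= ih [in RHS]big_ord_recr/= -(natr1 K); lra.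
Qed.

Lemma int01_sum (F : nat -> R -> R) m : (forall k, in_L1 (F k)) ->
  in_L1 (fun u => \sum_(k < m) F k u) /\
  int01 (fun u => \sum_(k < m) F k u) = \sum_(k < m) int01 (F k).
Proof.
move=> iF; elim: m => [|m [ih1 ih2]].
  have E : (fun u => \sum_(k < 0) F k u) = cst 0 by apply/funext => u; rewrite big_ord0.
  rewrite E; split; first exact: L1_cst.
  by rewrite big_ord0 /int01 Rintegral_cst// mul0r.
have -> : (fun u => \sum_(k < m.+1) F k u) = (fun u => \sum_(k < m) F k u + F m u).
  by apply/funext => u; rewrite big_ord_recr.
by split; [exact: L1D|rewrite int01D// ih2 big_ord_recr].
Qed.

(** If w takes the values -1, 0, 1 and is carried by a set of measure al, the
    integral of |T w| over a set B grows at most linearly in the logarithm of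
    the measure of B. *)
Lemma int_Tn_indic_le n (w : nat -> R) (B : set R) k (al t : R) : ms01 B ->
  (forall j, w j ^+ 2 = `|w j|) -> mean n (fun j => `|w j|) = al ->
  msr B <= 2 ^+ k.+1 * t -> t <= 2 * al ->
  int01 (fun u => `|Tn n (step n w) u| * \1_B u) <= al * (2 * k%:R + 5).
Proof.
move=> mB w2 wal mBt tal.
have iW := L1_step n w.
set W := step n w in iW *; set h := mtransform th (avg W) n.
pose H := step n h.
have iW1 : int01 (fun u => `|W u|) = al.
  by rewrite -wal -int01_step; apply: int01_eq.
pose F (i : nat) : R -> R := step n (fun j => 2^-1 ^+ i * (2^-1 ^+ i.+1 < `|h j|)%R%:R).
have iF i : in_L1 (F i) by exact: L1_step.
have [iS iSE] := int01_sum k.+1 iF.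
have iH2 : in_L1 (step n (fun j => h j ^+ 2)) by exact: L1_step.
have iB : in_L1 (fun u => 2^-1 ^+ k.+1 * \1_B u) by apply: L1Z; exact: L1_indic.
apply: (@le_trans _ _ (int01 (fun u => step n (fun j => h j ^+ 2) u +
   (\sum_(i < k.+1) F i u + 2^-1 ^+ k.+1 * \1_B u)))).
  apply: int01_le.
  - by apply: L1_mul_indic => //; apply: L1_norm; exact: L1_step.
  - by apply: L1D => //; exact: L1D.
  move=> u Uu; rewrite /Tn /F /step -/h; set v := h _.
  have := le_sum_levels_sqr k.+1 (normr_ge0 v); rewrite real_normK ?num_real//.
  have S0 : 0 <= \sum_(i < k.+1) 2^-1 ^+ i * (2^-1 ^+ i.+1 < `|v|)%R%:R :> R.
    by apply: sumr_ge0 => i _; rewrite mulr_ge0 ?exprn_ge0.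
  have := sqr_ge0 v; rewrite indicE; case: (_ \in _) => /=; lra.
rewrite int01D//; last exact: L1D.
rewrite int01D// iSE int01Z; last exact: L1_indic.
rewrite int01_indic// int01_step.
have E1 : mean n (fun j => h j ^+ 2) <= al.
  apply: le_trans (mtransform_L2 th n (avg_dmart iW)) _.
  by rewrite -wal; apply: le_mean => j jn; rewrite avg_step// w2.
have E2 : \sum_(i < k.+1) int01 (F i) <= \sum_(i < k.+1) (2 * al).
  apply: ler_sum => i _; rewrite [leLHS]int01_step meanZ.
  have p0 : 0 < 2^-1 ^+ i.+1 :> R by rewrite exprn_gt0.
  have := Tn_weak n iW p0; rewrite iW1 dist_step -/h exprS; lra.
have E3 : 2^-1 ^+ k.+1 * msr B <= 2 * al.
  apply: le_trans tal; rewrite exprVn ler_pdivrMl ?exprn_gt0//.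
move: E2; rewrite sumr_const card_ord -[_ *+ k.+1]mulr_natl -(natr1 k); lra.
Qed.


Lemma rearr_pow_nincr x t k : meas01 x -> 0 < t ->
  rearr x (2 ^+ k.+1 * t) <= rearr x (2 ^+ k * t).
Proof.
move=> mx t0; have p : 0 < 2 ^+ k * t by rewrite mulr_gt0 ?exprn_gt0.
by apply: rearr_nincr => //; rewrite exprS; lra.
Qed.

Lemma itv_sub_unit a b : 0 <= a -> b <= 1 -> `]a, b[ `<=` U.
Proof.
move=> a0 b1 u /=; rewrite in_itv/= => /andP[au ub]; apply/unit_itvP.
by rewrite (le_lt_trans a0)// (lt_le_trans ub).
Qed.

Lemma ms01_itv a b : ms01 (`]a, b[ : set R).
Proof. by apply: measurableI => //; exact: measurable_itv. Qed.

Lemma msr_itv a b : 0 <= a -> a <= b -> b <= 1 -> msr (`]a, b[ : set R) = b - a.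
Proof.
move=> a0 ab b1; rewrite /msr setIidr; last exact: itv_sub_unit.
rewrite lebesgue_measure_itv/= lte_fin; case: ltP => //= ba.
by apply/esym/eqP; rewrite subr_eq0 eq_le ab ba.
Qed.

Lemma L1_rearr_div x t : in_L1 x -> 0 < t ->
  in_L1 (fun u => rearr x u / u * \1_(`]t, 1[ : set R) u).
Proof.
move=> ix t0; have mx := L1_meas ix.
apply: (@L1_le _ (fun u => t^-1 * rearr x u)).
- apply: measurable_funM; last by apply: meas_indic; exact: ms01_itv.
  apply: measurable_funM; first exact: meas_rearr.
  apply: open_continuous_measurable_fun; first exact: interval_open.
  by move=> u; rewrite inE => /unit_itvP/andP[u0 _]; apply: inv_continuous; rewrite gt_eqF.
- by apply: L1Z; exact: L1_rearr.
move=> u /unit_itvP/andP[u0 u1]; rewrite indicE.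
have r0 : 0 <= rearr x u by exact: rearr_ge0.
case: (boolP (u \in _)) => /=; rewrite ?mulr0 ?normr0// inE/= in_itv/= mulr1 => /andP[tu _].
rewrite !normrM !normfV mulrC ler_wpM2r// lef_pV2 ?posrE ?normr_gt0 ?gt_eqF//.
by rewrite !gtr0_norm// ltW.
Qed.

Lemma indic_itv a b u : \1_(`]a, b[ : set R) u = (a < u < b)%R%:R :> R.
Proof.
by rewrite indicE; congr (nat_of_bool _)%:R; apply/idP/idP; rewrite inE/= in_itv.
Qed.

(** Dyadic comparison of the integral of rearr x u / u with the values
    rearr x (2^k t): on (2^k t, 2^(k+1) t) the integrand is at least
    rearr x (2^(k+1) t) / (2^(k+1) t). *)
Lemma sum_rearr_le x t m : in_L1 x -> 0 < t -> 2 ^+ m * t <= 1 ->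
  \sum_(k < m) rearr x (2 ^+ k.+1 * t) <=
  2 * int01 (fun u => rearr x u / u * \1_(`]t, 1[ : set R)
      u * \1_(`]t, 2 ^+ m * t[ : set R) u).
Proof.
move=> ix t0; have mx := L1_meas ix.
have iF b := L1_mul_indic (L1_rearr_div ix t0) (ms01_itv t b).
elim: m => [|m ih] m1.
  rewrite big_ord0 mulr_ge0// int01_ge0// => u /unit_itvP/andP[u0 u1].
  by rewrite !mulr_ge0 ?invr_ge0 ?(ltW u0)// rearr_ge0.
have p0 : 0 < 2 ^+ m * t by rewrite mulr_gt0 ?exprn_gt0.
have pE : 2 ^+ m.+1 * t = 2 * (2 ^+ m * t) by rewrite exprS mulrA.
have tp : t <= 2 ^+ m * t by rewrite ler_peMl ?(ltW t0)// exprn_ege1// ler1n.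
rewrite big_ord_recr/=; set c := rearr x (2 ^+ m.+1 * t).
pose J b := int01 (fun u => rearr x u / u * \1_(`]t, 1[ : set R) u * \1_(`]t, b[ : set R)
    u).
have m1p : 2 ^+ m * t <= 1 by move: m1; rewrite pE; lra.
have {}ih := ih m1p.
suff : J (2 ^+ m * t) + c / 2 <= J (2 ^+ m.+1 * t) by rewrite /J; lra.
pose S := (`]2 ^+ m * t, 2 ^+ m.+1 * t[%classic : set R).
have mS : ms01 S by exact: ms01_itv.
have iS : in_L1 (fun u => c / (2 ^+ m.+1 * t) * \1_S u) by apply: L1Z; exact: L1_indic.
have <- : int01 (fun u => c / (2 ^+ m.+1 * t) * \1_S u) = c / 2.
  rewrite int01Z ?int01_indic//; last exact: L1_indic.
  rewrite msr_itv//; [|lra|lra].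
  rewrite pE; move: p0; move: (2 ^+ m * t) => p p0.
  have -> : 2 * p - p = p by lra.
  by rewrite invfM mulrA -[LHS]mulrA mulVf ?mulr1// gt_eqF.
rewrite /J -int01D//; apply: int01_le => //; first exact: L1D.
move=> u /unit_itvP/andP[u0 u1]; rewrite /S !indic_itv u1.
have f0 : 0 <= rearr x u / u by rewrite divr_ge0 ?(ltW u0)// rearr_ge0.
have [up|pu] := leP u (2 ^+ m * t).
  rewrite mulr0 addr0; case: (ltP t u) => tu /=; rewrite ?mulr0 ?mul0r ?mulr1//.
  have -> : (u < 2 ^+ m.+1 * t) by lra.
  by case: (_ < _); rewrite ?mulr1 ?mulr0.
have tu : t < u by lra.
rewrite tu (ltNge u) (ltW pu) /= mulr0 add0r mulr1.
have [up|up] := ltP; last by rewrite !mulr0.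
rewrite !mulr1; apply: ler_pM.
- by apply: rearr_ge0 => //; lra.
- by rewrite invr_ge0; lra.
- by apply: rearr_nincr => //; exact: ltW.
- by rewrite lef_pV2 ?posrE ?ltW//; lra.
Qed.

Lemma ex_dyadic_scale t : 0 < t < 1 -> exists K : nat, 2 ^+ K * t < 1 <= 2 ^+ K.+1 * t.
Proof.
move=> /andP[t0 t1].
have ex : exists k : nat, 1 <= 2 ^+ k * t.
  exists (Num.truncn t^-1).+1; rewrite -ler_pdivrMr// mul1r;
      apply: le_trans (ltW (truncnS_gt _)) _.
  by rewrite -natrX ler_nat ltnW// ltn_expl.
case: (ex_minnP ex) => -[|K] K1 Kmin; first by move: K1; rewrite expr0 mul1r leNgt t1.
by exists K; rewrite K1 andbT ltNge; apply/negP => /Kmin; rewrite ltnn.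
Qed.

(** The part of x where |x| does not exceed s. *)
Definition below x s : R -> R := fun u => x u - above x s u.

Lemma belowE x s u : below x s u = if s < `|x u| then 0 else x u.
Proof. by rewrite /below aboveE; case: ifP; rewrite ?subrr ?subr0. Qed.

Lemma L1_above x s : in_L1 x -> in_L1 (above x s).
Proof. by move=> ix; apply: L1_mul_indic => //; apply: ms01_dset; exact: L1_meas. Qed.

Lemma L1_below x s : in_L1 x -> in_L1 (below x s).
Proof. by move=> ix; apply: L1B => //; exact: L1_above. Qed.

(** Testing T x against the sign w of T x on the set where |T x| > l. *)
Lemma Tn_dual n x l : in_L1 x -> 0 < l ->
  exists w : nat -> R, [/\ forall j, w j ^+ 2 = `|w j|,
    mean n (fun j => `|w j|) = dist (Tn n x) l &
    l * dist (Tn n x) l <= int01 (fun u => `|x u| * `|Tn n (step n w) u|)].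
Proof.
move=> ix l0; set c := mtransform th (avg x) n.
pose w j : R := if l < `|c j| then Num.sg (c j) else 0.
exists w.
have nw j : `|w j| = (l < `|c j|)%R%:R.
  rewrite /w; case: ifPn => [lc|_]; last by rewrite normr0.
  by rewrite normr_sg; have := lt_trans l0 lc; rewrite normr_gt0 => ->.
split.
- move=> j; rewrite -real_normK ?num_real// nw; case: (_ < _); rewrite ?expr1n ?expr0n//.
- by rewrite dist_step; apply: eq_mean => j _; rewrite nw.
have iW := L1_step n w.
rewrite dist_step -meanZ.
apply: (@le_trans _ _ (mean n (fun j => c j * avg (step n w) n j))).
  apply: le_mean => j jn; rewrite avg_step// /w; case: ifPn => lc; last by rewrite !mulr0.
  by rewrite mulr1 mulrC -normrEsg ltW.
rewrite mtransform_selfadjoint; [|exact: avg_dmart|exact: avg_dmart].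
rewrite -int01_mul_step//; apply: le_trans (ler_norm _) _.
apply: le_trans (int01_norm _) _; first exact: L1_mul_step.
by rewrite le_eqVlt; apply/orP; left; apply/eqP/int01_eq => u _; rewrite normrM.
Qed.

(** A level exceeded by the transform of the part of x below rearr x t on a set of
    measure more than t / 2 is small. *)
Lemma below_bound x t n l : in_L1 x -> 0 < t < 1 -> 0 < l ->
  t / 2 < dist (Tn n (below x (rearr x t))) l ->
  l <= 5 * rearr x t + 4 * Rintegral mu `]t, 1[ (fun u => rearr x u / u).
Proof.
move=> ix /[dup] t01 /andP[t0 t1] l0 ta; have mx := L1_meas ix.
have [K /andP[K1 K2]] := ex_dyadic_scale t01.
set x2 := below x _ in ta *; have ix2 : in_L1 x2 by exact: L1_below.
have [w [w2 wal wle]] := Tn_dual n ix2 l0.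
set al := dist _ _ in ta wal wle.
pose a k := rearr x (2 ^+ k * t).
have na k : a k.+1 <= a k by exact: rearr_pow_nincr.
(* The scale K.+1 is chosen with 2^(K+1) t >= 1, where the rearrangement vanishes. *)
have aK : a K.+1 = 0 by exact: rearr_ge1.
have a0 : a 0%N = rearr x t by rewrite /a expr0 mul1r.
pose H := fun u => `|Tn n (step n w) u|.
have iH : in_L1 H by apply: L1_norm; exact: L1_step.
have mB k : ms01 (dset x (a k)) by exact: ms01_dset.
pose F (k : nat) : R -> R := fun u => (a k - a k.+1) * (H u * \1_(dset x (a k.+1)) u).
have iF k : in_L1 (F k) by apply: L1Z; apply: L1_mul_indic.
have [iS iSE] := int01_sum K.+1 iF.
(* Replace |x2| by its layers, then bound each layer and sum by parts. *)
have le1 : l * al <= \sum_(k < K.+1) int01 (F k).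
  apply: le_trans wle _; rewrite -iSE; apply: int01_le => //.
    have [C HC] := step_bounded n (fun j => `|mtransform th (avg (step n w)) n j|).
    apply: (L1_mul (C := C)); [exact: L1_norm|by apply: L1_meas|].
    by move=> u Uu; exact: HC.
  move=> u Uu; rewrite -/(H u); have H0 : 0 <= H u by rewrite /H.
  rewrite (eq_bigr (fun k : 'I_K.+1 => ((a k - a k.+1) * (a k.+1 < `|x u|)%R%:R) * H u));
      last first.
    move=> k _; rewrite /F indicE -mulrA; congr (_ * _); rewrite mulrC; congr (_%:R * _).
    by congr nat_of_bool; apply/idP/idP; rewrite inE.
  rewrite -mulr_suml ler_wpM2r// /x2 belowE; case: ifPn => xu.
    by rewrite normr0 sumr_ge0// => k _; rewrite mulr_ge0// subr_ge0.
  have := @le_sum_levels a `|x u| K.+1 na; rewrite aK addr0; apply.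
  by rewrite a0 leNgt.
have le2 : \sum_(k < K.+1) int01 (F k) <=
    \sum_(k < K.+1) al * ((a k - a k.+1) * (2 * k%:R + 5)).
  apply: ler_sum => k _; rewrite /F int01Z; last exact: L1_mul_indic.
  rewrite mulrCA ler_wpM2l ?subr_ge0//; apply: (int_Tn_indic_le (t := t)) => //; last lra.
  apply: dist_rearr => //; rewrite mulr_gt0// exprn_gt0//.
have le3 : l * al <= al * (5 * a 0%N + 2 * \sum_(k < K) a k.+1).
  apply: le_trans le1 (le_trans le2 _).
  by rewrite -mulr_sumr sum_levels_by_parts aK mulr0 subr0.
have al0 : 0 < al by lra.
move: le3; rewrite mulrC ler_pM2l// => /le_trans; apply.
rewrite a0 lerD2l.
have -> : 4 = 2 * 2 :> R by lra.
rewrite -mulrA ler_pM2l//; apply: le_trans (sum_rearr_le ix t0 (ltW K1)) _.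
rewrite ler_pM2l// Rintegral_subE//; last exact: itv_sub_unit (ltW t0) (lexx _).
apply: int01_le.
- apply: L1_mul_indic; [exact: L1_rearr_div|exact: ms01_itv].
- exact: L1_rearr_div.
move=> u /unit_itvP/andP[u0 _].
have f0 : 0 <= rearr x u / u by rewrite divr_ge0 ?(ltW u0)// rearr_ge0.
rewrite -[leRHS]mulr1; apply: ler_wpM2l; first by rewrite mulr_ge0.
by rewrite indicE; case: (_ \in _).
Qed.

Lemma dist_add x y s s' : meas01 x -> meas01 y ->
  dist (fun u => x u + y u) (s + s') <= dist x s + dist y s'.
Proof.
move=> mx my.
apply: (@le_trans _ _ (msr (fun u => dset x s u \/ dset y s' u))).
  apply: msr_le.
  - by apply: ms01_dset; exact: measurable_funD.
  - by apply: ms01_or; exact: ms01_dset.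
  move=> u _; rewrite /dset/= => H; case: (ltP s `|x u|) => xs; first by left.
  by right; have := ler_normD (x u) (y u); lra.
by apply: msr_or; exact: ms01_dset.
Qed.

(** The Calderon bound, with an arbitrarily small d > 0 that covers the case
    where the right-hand side vanishes. *)
Lemma Tn_calderon_bound x t n d : in_L1 x -> 0 < t < 1 -> 0 < d ->
  dist (Tn n x) (7 * calderon (rearr x) t + d) <= t.
Proof.
move=> ix /[dup] t01 /andP[t0 t1] d0; have mx := L1_meas ix.
set M := rearr x t.
pose A := t^-1 * Rintegral mu `]0, t[ (rearr x).
pose B := Rintegral mu `]t, 1[ (fun u => rearr x u / u).
have M0 : 0 <= M by exact: rearr_ge0.
have B0 : 0 <= B.
  apply: Rintegral_ge0 => u /=; rewrite in_itv/= => /andP[tu _].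
  have u0 : 0 < u by exact: lt_trans tu.
  by rewrite divr_ge0 ?(ltW u0)// rearr_ge0.
have MA : M <= A.
  rewrite /A mulrC ler_pdivlMr// Rintegral_subE//;
      last exact: itv_sub_unit (lexx _) (ltW t1).
  have mt : ms01 (`]0, t[ : set R) by exact: ms01_itv.
  have -> : M * t = int01 (fun u => M * \1_(`]0, t[ : set R) u).
    by rewrite int01Z ?int01_indic ?msr_itv ?subr0// ?ltW//; exact: L1_indic.
  apply: int01_le; [by apply: L1Z; exact: L1_indic|by apply: L1_mul_indic => //;
      exact: L1_rearr|].
  move=> u /unit_itvP/andP[u0 _]; rewrite indic_itv u0/=; case: ltP => ut;
      rewrite ?mulr0// !mulr1.
  by apply: rearr_nincr => //; exact: ltW.
(* Each of l1 and l2 is exceeded on a set of measure at most t / 2. *)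
pose l1 := 2 / t * int01 (fun u => `|above x M u|) + d / 2.
pose l2 := 5 * M + 4 * B + d / 2.
have I0 : 0 <= int01 (fun u => `|above x M u|) by exact: int01_ge0.
have l10 : 0 < l1 by rewrite /l1 ltr_wpDl ?divr_gt0// mulr_ge0// divr_ge0// ltW.
have l20 : 0 < l2 by rewrite /l2; lra.
have L1le : dist (Tn n (above x M)) l1 <= t / 2.
  rewrite -(ler_pM2l l10); apply: le_trans (Tn_weak n (L1_above M ix) l10) _.
  rewrite /l1 mulrDl mulrAC.
  have -> : 2 / t * (t / 2) = 1 by rewrite mulrA divfK ?gt_eqF// divff.
  by rewrite mul1r lerDl mulr_ge0// ltW// divr_gt0.
have L2le : dist (Tn n (below x M)) l2 <= t / 2.
  by rewrite leNgt; apply/negP => /(below_bound ix t01 l20); rewrite -/M -/B /l2; lra.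
have E : Tn n x = (fun u => Tn n (above x M) u + Tn n (below x M) u).
  apply/funext => u; rewrite -TnD; [|exact: L1_above|exact: L1_below].
  by congr (Tn n _ u); apply/funext => v; rewrite /below addrC subrK.
apply: (@le_trans _ _ (dist (Tn n x) (l1 + l2))).
  apply: dist_le; first exact: meas_Tn.
  have TA : 2 / t * int01 (fun u => `|above x M u|) <= 2 * A.
    by rewrite /A -mulrA ler_pM2l// ler_pM2l ?invr_gt0// int01_above_le.
  by rewrite /calderon -/A -/B /l1 /l2; lra.
rewrite E; apply: le_trans (dist_add _ _ (meas_Tn _ _) (meas_Tn _ _)) _.
by rewrite [leRHS](_ : t = t / 2 + t / 2); [exact: lerD|lra].
Qed.

End Main.

(** * Dyadic approximation and convergence in measure *)

Section Limit.
Variable R : realType.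
Implicit Types (x y : R -> R) (S : set R) (s t : R).
Notation mu := (@lebesgue_measure R).
Notation U := (@unit_itv R).
#[local] Hint Extern 0 (measurable _) => solve [apply: measurable_unit_itv] : core.

Lemma cvge0_le (v : nat -> \bar R) e : v @ \oo --> 0%E -> (0 < e)%R ->
  exists N : nat, forall n, (N <= n)%N -> (v n <= e%:E)%E.
Proof.
move=> v0 e0.
have /v0 : nbhs (0%:E : \bar R) [set z | (z < e%:E)%E].
  by apply: open_nbhs_nbhs; split => /=; [exact: open_ereal_lt_ereal|rewrite lte_fin].
by move=> [N _ H]; exists N => n /H /ltW.
Qed.

Lemma truncn_cvg (u : R) : 0 <= u ->
  (fun n => (Num.truncn (2 ^+ n * u))%:R / 2 ^+ n : R) @ \oo --> u.
Proof.
move=> u0; apply/cvgrPdist_le => e e0.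
have : (fun n => 2^-1 ^+ n : R) @ \oo --> (0:R).
  by apply: cvg_expr; rewrite ger0_norm ?invr_ge0// invf_lt1// ltr1n.
move=> /cvgrPdist_le /(_ e e0); apply: filterS => n.
rewrite sub0r normrN ger0_norm ?exprn_ge0// => ne; apply: le_trans ne.
have p0 : 0 < 2 ^+ n :> R by rewrite exprn_gt0.
have /truncn_itv/andP[] : 0 <= 2 ^+ n * u by rewrite mulr_ge0// ltW.
move: (Num.truncn _) => k; rewrite -natr1 => k1 k2.
move: p0 k1 k2; rewrite exprVn; move: (2 ^+ n) => p p0 k1 k2.
have e1 : p * (k%:R / p) = k%:R by rewrite mulrC divfK ?gt_eqF.
have e2 : p * p^-1 = 1 by rewrite divff ?gt_eqF.
by rewrite ler_norml; apply/andP; split; rewrite -(ler_pM2l p0); lra.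
Qed.

Lemma truncn_div_itv n u : U u ->
  ((Num.truncn (2 ^+ n * u))%:R / 2 ^+ n : R) \in `[0, 1]%R.
Proof.
move=> Uu; rewrite in_itv/= divr_ge0 ?exprn_ge0//= ler_pdivrMr ?exprn_gt0// mul1r.
rewrite -[leRHS]natrX ler_nat; apply: ltnW; exact: truncn_lt.
Qed.

Lemma int01_EFin x : in_L1 x -> (\int[mu]_(u in U) (`|x u|)%:E)%E =
    (int01 (fun u => `|x u|))%:E.
Proof.
move=> ix; rewrite /int01 /Rintegral fineK//.
by apply: integrable_fin_num => //; exact: L1_norm.
Qed.

Lemma step_dense x e : in_L1 x -> 0 < e -> exists N, forall n, (N <= n)%N ->
  exists c, int01 (fun u => `|x u - step n c u|) <= e.
Proof.
move=> ix e0.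
have [g [cg ig g0]] := @approximation_continuous_integrable R U x (@measurable_unit_itv
    R) (mu_unit_itv_lty R) ix.
have [k /(_ k (leqnn k)) kE] := cvge0_le g0 (divr_gt0 e0 (ltr0n _ 2)).
have {ig} igk : in_L1 (g k) by exact: ig.
have cgk : continuous (g k) by exact: cg.
move: (g k) cgk igk kE => {cg g0}g cg ig ge.
have gx : int01 (fun u => `|x u - g u|) <= e / 2.
  by rewrite -lee_fin -int01_EFin//; exact: L1B.
have [c c01 gc] : exists2 c, c \in `[0, 1]%R & forall t, t \in `[0, 1]%R ->
    `|g t| <= `|g c|.
  apply: (@EVT_max R (fun u => `|g u|) 0 1 ler01).
  by apply: continuous_subspaceT => u; apply: continuous_comp (cg u) _;
      exact: norm_continuous.
(* Sample the continuous function g at the left end points. *)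
pose s n := step n (fun j => g (j%:R / 2 ^+ n)).
have sg u : U u -> s ^~ u @ \oo --> g u.
  move=> /unit_itvP/andP[/ltW u0 _].
  have -> : s ^~ u = g \o (fun n => (Num.truncn (2 ^+ n * u))%:R / 2 ^+ n) by [].
  apply: cvg_comp; [exact: truncn_cvg|exact: cg].
have := @dominated_convergence _ _ R mu U (@measurable_unit_itv R)
    (fun n u => (s n u)%:E) (fun u => (g u)%:E)
  (cst `|g c|%:E).
case.
- by move=> n; apply/measurable_EFinP; exact: meas_step.
- by apply/measurable_EFinP; exact: L1_meas.
- by apply: aeW => u Uu; apply: cvg_EFin; [exact: nearW|exact: sg].
- exact: L1_cst.
- by apply: aeW => u n Uu; rewrite /= lee_fin gc// truncn_div_itv.
move=> _ sg0 _; have [N HN] := cvge0_le sg0 (divr_gt0 e0 (ltr0n _ 2)).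
exists N => n /HN sn; exists (fun j => g (j%:R / 2 ^+ n)).
have iB : in_L1 (fun u => s n u - g u) by apply: L1B => //; exact: L1_step.
have sgn : int01 (fun u => `|s n u - g u|) <= e / 2.
  by rewrite -lee_fin -int01_EFin.
apply: (@le_trans _ _ (int01 (fun u => `|x u - g u| + `|s n u - g u|))).
  apply: int01_le.
  - by apply/L1_norm/L1B => //; exact: L1_step.
  - by apply: L1D; apply: L1_norm => //; exact: L1B.
  move=> u _; rewrite -/(s n u) [`|s n u - _|]distrC.
  by rewrite (_ : x u - s n u = x u - g u + (g u - s n u)) ?ler_normD//; lra.
rewrite int01D; [lra|by apply/L1_norm/L1B|exact: L1_norm].
Qed.


Lemma measB x y : meas01 x -> meas01 y -> meas01 (fun u => x u - y u).
Proof. by move=> mx my; exact: measurable_funB. Qed.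

Lemma measM x y : meas01 x -> meas01 y -> meas01 (fun u => x u * y u).
Proof. by move=> mx my; exact: measurable_funM. Qed.

Lemma measD x y : meas01 x -> meas01 y -> meas01 (fun u => x u + y u).
Proof. by move=> mx my; exact: measurable_funD. Qed.

Lemma ms01_not S : ms01 S -> ms01 (fun u => ~ S u).
Proof.
move=> mS; rewrite /ms01 (_ : _ `&` _ = U `\` (U `&` S)); first exact: measurableD.
apply/seteqP; split => u [Uu H]; split => //; first by move=> [].
by move=> Su; apply: H.
Qed.

Lemma ms01_ex (P : nat -> set R) : (forall k, ms01 (P k)) ->
    ms01 (fun u => exists k, P k u).
Proof.
move=> mP; rewrite /ms01 (_ : _ `&` _ = \bigcup_k (U `&` P k));
    first exact: bigcupT_measurable.
apply/seteqP; split => u; first by move=> [Uu [k Pk]]; exists k.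
by move=> [k _ [Uu Pk]]; split => //; exists k.
Qed.

Lemma msr_ex_le (P : nat -> set R) e : (forall k, ms01 (P k)) ->
  (forall m n u, (m <= n)%N -> P m u -> P n u) -> (forall k, msr (P k) <= e) ->
  msr (fun u => exists k, P k u) <= e.
Proof.
move=> mP ndP Pe.
have E : \bigcup_k (U `&` P k) = U `&` (fun u => exists k, P k u).
  apply/seteqP; split => u; last by move=> [Uu [k Pk]]; exists k.
  by move=> [k _ [Uu Pk]]; split => //; exists k.
have cF : mu \o (fun k => U `&` P k) @ \oo --> mu (U `&` (fun u => exists k, P k u)).
  rewrite -E; apply: nondecreasing_cvg_mu => //; first by rewrite E; exact: ms01_ex.
  by move=> m n mn; apply/subsetPset => u [Uu]; split => //; apply: ndP mn _.
rewrite -lee_fin -[leLHS]mu_fin; last exact: ms01_ex.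
apply: (cvge_to_le cF); apply: nearW => n.
by rewrite /= mu_fin ?lee_fin.
Qed.

Lemma half_pow_small (e : R) : 0 < e -> exists k : nat, 2^-1 ^+ k <= e.
Proof.
move=> e0; exists (Num.truncn e^-1).+1.
rewrite exprVn invf_ple ?posrE ?exprn_gt0//.
apply: le_trans (ltW (truncnS_gt _)) _.
by rewrite -natrX ler_nat ltnW// ltn_expl.
Qed.

(** A sequence whose successive differences are small in measure at a geometric
    rate converges in measure, at the same rate. *)
Lemma fast_cauchy_cvg (y : nat -> R -> R) : (forall k, meas01 (y k)) ->
  (forall k, dist (fun u => y k.+1 u - y k u) (2^-1 ^+ k) <= 2 * 2^-1 ^+ k) ->
  exists2 z, meas01 z & forall k, dist (fun u => z u - y k u) (2 * 2^-1 ^+ k) <=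
      4 * 2^-1 ^+ k.
Proof.
move=> my yk.
pose bad k := dset (fun u => y k.+1 u - y k u) (2^-1 ^+ k).
have mbad k : ms01 (bad k) by apply: ms01_dset; exact: measB.
(* Some difference with index in [k, k + m) is large. *)
pose bad_until k m : set R := fun u => exists j, (k <= j < k + m)%N /\ bad j u.
have mbad_until k m : ms01 (bad_until k m).
  by apply: ms01_ex => j; case: (k <= j < k + m)%N;
    [rewrite (_ : (fun u => _) = bad j)//; apply/seteqP; split => u //= -[]|
     rewrite (_ : (fun u => _) = set0) ?/ms01 ?setI0//; apply/seteqP; split => u //= -[]].
have msr_until k m : msr (bad_until k m) <= 4 * 2^-1 ^+ k - 4 * 2^-1 ^+ (k + m).
  elim: m => [|m ih].
    rewrite addn0 subrr (_ : bad_until k 0 = set0) /msr ?setI0 ?measure0//.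
    by apply/seteqP; split => u //= -[j []]; rewrite addn0; case: leqP.
  apply: (@le_trans _ _ (msr (fun u => bad_until k m u \/ bad (k + m) u))).
    apply: msr_le => //; first exact: ms01_or.
    move=> u _ [j [/andP[kj]]]; rewrite addnS ltnS leq_eqVlt => /predU1P[->|jm] bj;
        first by right.
    by left; exists j; rewrite kj jm.
  apply: le_trans (msr_or (mbad_until _ _) (mbad _)) _.
  have := yk (k + m)%N; rewrite addnS exprS; rewrite /dist -/(bad (k + m)%N); lra.
pose F k : set R := fun u => exists m, bad_until k m u.
have mF k : ms01 (F k) by exact: ms01_ex.
have msrF k : msr (F k) <= 4 * 2^-1 ^+ k.
  apply: msr_ex_le => // [m n u mn [j [/andP[kj jm] bj]]|m].
    by exists j; split=> //; rewrite kj (leq_trans jm)// leq_add2l.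
  apply: le_trans (msr_until k m) _; rewrite lerBlDr lerDl mulr_ge0// exprn_ge0//.
have nF k u m : ~ F k u -> `|y (k + m)%N u - y k u| <= 2 * 2^-1 ^+ k - 2 * 2^-1 ^+ (k + m).
  move=> nFu; elim: m => [|m ih]; first by rewrite addn0 !subrr normr0.
  have : ~ bad (k + m)%N u.
    by move=> b; apply: nFu; exists m.+1, (k + m)%N; rewrite leq_addr ltn_add2l leqnn.
  rewrite /bad /dset/= => /negP; rewrite -leNgt addnS exprS => b.
  have := ler_normD (y (k + m).+1 u - y (k + m)%N u) (y (k + m)%N u - y k u).
  by rewrite addrA subrK; lra.
(* Z has full measure, and the sequence converges at each point of Z. *)
pose Z : set R := fun u => exists k, ~ F k u.
have mZ : ms01 Z by apply: ms01_ex => k; exact: ms01_not.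
pose z' j u := y j u * \1_Z u.
have cz u : cvgn (z' ^~ u).
  rewrite /z' indicE; case: (pselect (Z u)) => [Zu|nZ]; last first.
    rewrite memNset//; under eq_fun do rewrite mulr0; exact: is_cvg_cst.
  rewrite mem_set//; under eq_fun do rewrite mulr1.
  case: Zu => k nFk; apply: cauchy_cvg; apply: cauchy_exP => e e0.
  have [j je] := half_pow_small (divr_gt0 e0 (ltr0n _ 4)).
  have nFj : ~ F (k + j)%N u.
    move=> [m [i [/andP[ki im] bi]]]; apply: nFk; exists (j + m)%N, i; split=> //.
    by rewrite addnA im (leq_trans _ ki)// leq_addr.
  exists (y (k + j)%N u), (k + j)%N => // n /= /subnKC <-.
  rewrite /ball/= distrC; apply: le_lt_trans (nF _ _ _ nFj) _.
  have : 2^-1 ^+ (k + j) <= 2^-1 ^+ j :> R.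
    rewrite exprD ler_piMl ?exprn_ge0// exprn_ile1//; lra.
  have : 0 < 2^-1 ^+ (k + j + (n - (k + j))) :> R by rewrite exprn_gt0.
  lra.
exists (fun u => limn (z' ^~ u)).
  apply: (@measurable_fun_cvg _ _ _ U z') => [m|u _]; last exact: cz.
  by apply: measM => //; exact: meas_indic.
move=> k; apply: le_trans (msrF k); apply: msr_le => //.
  apply: ms01_dset; apply: measB => //.
  apply: (@measurable_fun_cvg _ _ _ U z') => [m|u _]; last exact: cz.
  by apply: measM => //; exact: meas_indic.
move=> u _; rewrite /dset/= => H; apply: contrapT => nFk.
have Zu : Z u by exists k.
move: H; apply/negP; rewrite -leNgt; apply/ler_addgt0Pr => e e0.
have /cvgrPdist_le /(_ e e0) [j _ /(_ (k + j)%N (leq_addl _ _))] := cz u.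
have -> : z' (k + j)%N u = y (k + j)%N u by rewrite /z' indicE mem_set// mulr1.
set l := limn _ => lj.
have := ler_normD (l - y (k + j)%N u) (y (k + j)%N u - y k u).
have := nF k u j nFk; have : 0 < 2^-1 ^+ (k + j) :> R by rewrite exprn_gt0.
rewrite addrA subrK; lra.
Qed.

End Limit.

(** * Existence of the limit transform *)

Section Transform.
Variable R : realType.
Implicit Types (x y : R -> R) (S : set R) (s t : R) (th : nat -> bool).
Notation mu := (@lebesgue_measure R).
Notation U := (@unit_itv R).
#[local] Hint Extern 0 (measurable _) => solve [apply: measurable_unit_itv] : core.

(** x is equal on the unit interval to the step function of level n given by c. *)
Definition is_step n c x := forall u, U u -> x u = step n c u.

Lemma is_stepS n c x : is_step n c x -> is_step n.+1 (fun j => c j./2) x.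
Proof.
move=> xs u Uu; rewrite xs// /step truncn_half//.
by move/unit_itvP: Uu => /andP[/ltW].
Qed.

Lemma avg_is_step n c x j : is_step n c x -> (j < 2 ^ n)%N -> avg x n j = c j.
Proof.
move=> xs jn; rewrite -(avg_step c jn) /avg; congr (_ * _); apply: eq_Rintegral => u.
by rewrite inE => -[Uu _]; exact: xs.
Qed.

Lemma Tn_stabS th n c x u : is_step n c x -> U u -> Tn th n.+1 x u = Tn th n x u.
Proof.
move=> xs Uu; have u0 : 0 <= u by move/unit_itvP: Uu => /andP[/ltW].
rewrite /Tn /step /= [Num.truncn (2 ^+ n * u)]truncn_half//.
set j := Num.truncn _.
have jn : (j < 2 ^ n.+1)%N by exact: truncn_lt.
have j2n : (j./2 < 2 ^ n)%N by rewrite ltn_half_double -mul2n -expnS.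
by rewrite (avg_is_step (is_stepS xs))// (avg_is_step xs)// subrr; case: ifP; rewrite addr0.
Qed.

Lemma is_step_ge n m c x : is_step n c x -> (n <= m)%N -> exists c', is_step m c' x.
Proof.
move=> xs /subnKC <-; elim: (m - n)%N => [|k [c' ih]]; first by exists c; rewrite addn0.
by exists (fun j => c' j./2); rewrite addnS; exact: is_stepS.
Qed.

(** The truncations of the transform of a step function of level n are all equal
    from level n on. *)
Lemma Tn_stab th n m c x u : is_step n c x -> (n <= m)%N -> U u ->
    Tn th m x u = Tn th n x u.
Proof.
move=> xs /subnKC <- Uu; elim: (m - n)%N => [|k ih]; first by rewrite addn0.
have [c' xs'] := is_step_ge xs (leq_addr k n).
by rewrite addnS (Tn_stabS _ xs').
Qed.

Lemma Tn_compl th n x u : Tn th n x u + Tn (negb \o th) n x u = step n (avg x n) u.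
Proof. by rewrite /Tn /step mtransform_compl. Qed.

Lemma markov01 x l : in_L1 x -> 0 < l -> l * dist x l <= int01 (fun u => `|x u|).
Proof.
move=> ix l0; have mx := L1_meas ix; have mS : ms01 (dset x l) by exact: ms01_dset.
rewrite /dist -int01_indic// -int01Z; last exact: L1_indic.
apply: int01_le; [by apply: L1Z; exact: L1_indic|exact: L1_norm|].
move=> u _; rewrite indicE; case: (boolP (_ \in _)); rewrite ?mulr0 ?mulr1//.
by rewrite inE /dset/= => /ltW.
Qed.

Lemma dist_eq x y s : (forall u, U u -> x u = y u) -> dist x s = dist y s.
Proof. by move=> xy; apply: msr_eq => u Uu; rewrite /dset/= xy. Qed.

(** Convergence in measure on the unit interval. *)
Definition cvm (v : nat -> R -> R) y := forall d e : R, 0 < d -> 0 < e ->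
  exists n0, forall n, (n0 <= n)%N -> dist (fun u => y u - v n u) d <= e.

(** y is the limit in measure of the truncated transforms of x, that is a
    representative of T x. *)
Definition Tlim th x y := meas01 y /\ cvm (fun n => Tn th n x) y.

Lemma cvmD v w y z : (forall n, meas01 (v n)) -> (forall n, meas01 (w n)) -> meas01 y ->
    meas01 z ->
  cvm v y -> cvm w z -> cvm (fun n u => v n u + w n u) (fun u => y u + z u).
Proof.
move=> mv mw my mz vy wz d e d0 e0.
have d20 : 0 < d / 2 by lra.
have e20 : 0 < e / 2 by lra.
have [n1 H1] := vy _ _ d20 e20; have [n2 H2] := wz _ _ d20 e20.
exists (maxn n1 n2) => n; rewrite geq_max => /andP[/H1 {}H1 /H2 {}H2].
rewrite [X in dist X](_ : _ = (fun u => (y u - v n u) + (z u - w n u))); last first.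
  by apply/funext => u; lra.
have -> : d = d / 2 + d / 2 by lra.
apply: le_trans (dist_add _ _ _ _) _; [exact: measB|exact: measB|lra].
Qed.

Lemma distN x s : dist (fun u => - x u) s = dist x s.
Proof. by apply: msr_eq => u _; rewrite /dset/= normrN. Qed.

Lemma cvmN v y : cvm v y -> cvm (fun n u => - v n u) (fun u => - y u).
Proof.
move=> vy d e d0 e0; have [n0 H] := vy d e d0 e0; exists n0 => n /H.
by rewrite -distN; congr (dist _ _ <= _); apply/funext => u; lra.
Qed.

Lemma cvmZ (a : R) v y : (forall n, meas01 (v n)) -> meas01 y ->
  cvm v y -> cvm (fun n u => a * v n u) (fun u => a * y u).
Proof.
move=> mv my vy d e d0 e0.
have b0 : 0 < `|a| + 1 by have := normr_ge0 a; lra.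
have [n0 H] := vy _ _ (divr_gt0 d0 b0) e0.
exists n0 => n /H; apply: le_trans; apply: msr_le.
- by apply: ms01_dset; apply: measB; apply: measZ.
- by apply: ms01_dset; apply: measB.
move=> u _; rewrite /dset/= -mulrBr normrM ltr_pdivrMr// => /lt_le_trans; apply.
by rewrite mulrC ler_wpM2l// lerDl.
Qed.

(** The rearrangement of z vanishes, hence so does z. *)
Lemma small_dist_eq0 z : meas01 z -> (forall d e : R, 0 < d -> 0 < e -> dist z d <= e) ->
    eq01 z (cst 0).
Proof.
move=> mz H.
(* [dist_rearr] at every t then gives dist z 0 = 0. *)
have r0 (t : R) : 0 < t -> rearr z t = 0.
  move=> t0; apply/eqP; rewrite eq_le rearr_ge0// andbT.
  by apply/ler_addgt0Pr => d d0; rewrite add0r; apply: rearr_le => //;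
      [exact: ltW|exact: H].
have d0 : dist z 0 = 0.
  apply/eqP; rewrite eq_le dist_ge0 andbT; apply/ler_addgt0Pr => e e0.
  by rewrite add0r -{1}(r0 e e0); exact: dist_rearr.
exists (U `&` dset z 0); split; first exact: ms01_dset.
  by rewrite [LHS]mu_fin ?d0//; [rewrite -/(dist z 0) d0|exact: ms01_dset].
move=> u /= /not_implyP[Uu zu]; split=> //; rewrite /dset/= normr_gt0.
by apply/eqP.
Qed.

Lemma eq01_sub x y : eq01 (fun u => x u - y u) (cst 0) -> eq01 x y.
Proof. by apply: filterS => u H Uu; apply/eqP; rewrite -subr_eq0 H. Qed.

Lemma cvm_unique v y z : (forall n, meas01 (v n)) -> meas01 y -> meas01 z ->
  cvm v y -> cvm v z -> eq01 y z.
Proof.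
move=> mv my mz vy vz; apply: eq01_sub; apply: small_dist_eq0; first exact: measB.
move=> d e d0 e0.
have mz' : meas01 (fun u => - z u) by apply: measurable_funN.
have mv' n : meas01 (fun u => - v n u) by apply: measurable_funN; exact: mv.
have [n H] := cvmD mv mv' my mz' vy (cvmN vz) d0 e0.
apply: le_trans (H _ (leqnn _)); rewrite le_eqVlt; apply/orP; left.
by apply/eqP/dist_eq => u _; lra.
Qed.

Lemma TnB th n x y u : in_L1 x -> in_L1 y ->
  Tn th n (fun u => x u - y u) u = Tn th n x u - Tn th n y u.
Proof.
move=> ix iy; rewrite (_ : (fun u => _) = (fun u => x u + (-1) * y u)); last first.
  by apply/funext => v; lra.
rewrite TnD//; last exact: L1Z.
by rewrite TnZ// mulN1r.
Qed.

(** Step functions s k that approximate x fast in L_1 have transforms that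
    converge in measure, by the weak type inequality. *)
Lemma Tlim_ex th x : in_L1 x -> exists y, Tlim th x y.
Proof.
move=> ix.
have /choice[p Hp] : forall k : nat, exists p : nat * (nat -> R),
    int01 (fun u => `|x u - step p.1 p.2 u|) <= 4^-1 ^+ k.
  move=> k; have e0 : 0 < 4^-1 ^+ k :> R by rewrite exprn_gt0.
  have [N H] := step_dense ix e0; have [c Hc] := H N (leqnn _).
  by exists (N, c).
pose s k := step (p k).1 (p k).2.
have is_ k : in_L1 (s k) by exact: L1_step.
have ss k : is_step (p k).1 (p k).2 (s k) by [].
pose y k := Tn th (p k).1 (s k).
have yk k : dist (fun u => y k.+1 u - y k u) (2^-1 ^+ k) <= 2 * 2^-1 ^+ k.
  pose m := maxn (p k).1 (p k.+1).1.
  have p0 : 0 < 2^-1 ^+ k :> R by rewrite exprn_gt0.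
  have iss : in_L1 (fun u => s k.+1 u - s k u) by exact: L1B.
  rewrite (@dist_eq _ (Tn th m (fun u => s k.+1 u - s k u))); last first.
    by move=> u Uu; rewrite TnB// (Tn_stab _ (ss k)
        (leq_maxl _ _))// (Tn_stab _ (ss k.+1) (leq_maxr _ _)).
  rewrite -(ler_pM2l p0); apply: le_trans (Tn_weak th m iss p0) _.
  apply: (@le_trans _ _ (int01 (fun u => `|x u - s k.+1 u| + `|x u - s k u|))).
    apply: int01_le; [exact: L1_norm|by apply: L1D; apply/L1_norm/L1B|].
    move=> u _; rewrite [`|x u - s k.+1 u|]distrC.
    by have := ler_normD (s k.+1 u - x u) (x u - s k u); rewrite addrA subrK.
  rewrite int01D; [|by apply/L1_norm/L1B|by apply/L1_norm/L1B].
  have E4 : 4^-1 ^+ k = 2^-1 ^+ k * 2^-1 ^+ k :> R by rewrite -exprMn; congr (_ ^+ _); lra.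
  have := Hp k; have := Hp k.+1; rewrite exprS E4; nra.
have [z mz Hz] := fast_cauchy_cvg (fun k => meas_Tn th (p k).1 (s k)) yk.
exists z; split=> // d e d0 e0.
(* The index k makes z - y k and T (s k - x) both small in measure. *)
have m0 : 0 < Num.min (d / 4) (Num.min (e / 8) (e * d / 4)).
  by rewrite !lt_min !divr_gt0// mulr_gt0.
have [k] := half_pow_small m0; rewrite !le_min => /and3P[k1 k2 k3].
exists (p k).1 => n nk.
have ixs : in_L1 (fun u => s k u - x u) by exact: L1B.
rewrite (@dist_eq _ (fun u => (z u - y k u) + Tn th n (fun u => s k u - x u) u));
    last first.
  by move=> u Uu; rewrite TnB// (Tn_stab _ (ss k) nk)// /y; lra.
have p0 : 0 < 2^-1 ^+ k :> R by rewrite exprn_gt0.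
have p1 : 2^-1 ^+ k <= 1 :> R by rewrite exprn_ile1//; lra.
apply: (@le_trans _ _ (dist (fun u => (z u - y k u) + Tn th n (fun u => s k u - x u) u)
    (2 * 2^-1 ^+ k + d / 2))).
  apply: dist_le; last lra.
  by apply: measD; [apply: measB => //; exact: meas_Tn|exact: meas_Tn].
apply: le_trans (dist_add _ _ _ _) _; [by apply: measB => //;
    exact: meas_Tn|exact: meas_Tn|].
have d20 : 0 < d / 2 by lra.
have := Tn_weak th n ixs d20.
have -> : int01 (fun u => `|s k u - x u|) = int01 (fun u => `|x u - s k u|).
  by apply: int01_eq => u _; rewrite distrC.
have E4 : 4^-1 ^+ k = 2^-1 ^+ k * 2^-1 ^+ k :> R by rewrite -exprMn; congr (_ ^+ _); lra.
move=> W; have := Hp k; rewrite E4 => H.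
have := Hz k.
set A := dist _ _ in W *; set B := dist _ _.
have HA : A <= e / 2.
  rewrite -(ler_pM2l d20); apply: le_trans W (le_trans H _).
  have : 2^-1 ^+ k * 2^-1 ^+ k <= 2^-1 ^+ k * 1 :> R by rewrite ler_pM2l.
  lra.
lra.
Qed.

End Transform.

(** * Properties of the limit transform *)

Section Final.
Variable R : realType.
Implicit Types (x y : R -> R) (S : set R) (s t : R) (th : nat -> bool).
Notation mu := (@lebesgue_measure R).
Notation U := (@unit_itv R).
#[local] Hint Extern 0 (measurable _) => solve [apply: measurable_unit_itv] : core.

Lemma cvm_ext (v w : nat -> R -> R) y : (forall n u, U u -> v n u = w n u) -> cvm v y ->
    cvm w y.
Proof.
move=> vw H d e d0 e0; have [n0 Hn] := H d e d0 e0; exists n0 => n /Hn.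
by rewrite (@dist_eq _ _ (fun u => y u - w n u))// => u Uu; rewrite vw.
Qed.

Lemma Tlim_add th x y Tx Ty : in_L1 x -> in_L1 y -> Tlim th x Tx -> Tlim th y Ty ->
  Tlim th (x \+ y) (Tx \+ Ty).
Proof.
move=> ix iy [mx cx] [my cy]; split; first exact: measD.
apply: cvm_ext (cvmD (meas_Tn th ^~ x) (meas_Tn th ^~ y) mx my cx cy) => n u _.
exact/esym/(TnD th n u ix iy).
Qed.

Lemma Tlim_scale th (a : R) x Tx : in_L1 x -> Tlim th x Tx -> Tlim th (a \*o x) (a \*o Tx).
Proof.
move=> ix [mx cx]; split; first exact: measZ.
apply: cvm_ext (cvmZ a (meas_Tn th ^~ x) mx cx) => n u _.
exact/esym/(TnZ th n a u ix).
Qed.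

Lemma Tlim_unique th x y z : Tlim th x y -> Tlim th x z -> eq01 y z.
Proof. by move=> [my cy] [mz cz]; apply: cvm_unique cy cz => // n; exact: meas_Tn. Qed.

Lemma Tlim_ae th x x' y : in_L1 x -> in_L1 x' -> eq01 x x' -> Tlim th x y -> Tlim th x' y.
Proof.
move=> ix ix' xx' [my cy]; split=> //; apply: cvm_ext cy => n u _.
rewrite /Tn /step; congr (mtransform th _ n _); apply/funext => m; apply/funext => j.
rewrite /avg /Rintegral; congr (_ * fine _).
have mD := measurable_dyad (R := R) m j.
have sD := @dyad_sub_unit R m j.
apply: ae_eq_integral => //.
- by apply/measurable_EFinP; apply: measurable_funS (L1_meas ix).
- by apply/measurable_EFinP; apply: measurable_funS (L1_meas ix').
by apply: filterS xx' => v H /sD /H /= ->.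
Qed.

(** Both transforms add up to E_n x at level n, and E_n x tends to x in
    measure. *)
Lemma Tlim_compl th x y z : in_L1 x -> Tlim th x y -> Tlim (negb \o th) x z ->
    eq01 (y \+ z) x.
Proof.
move=> ix [my cy] [mz cz].
have mx := L1_meas ix.
apply: (cvm_unique (v := fun n => step n (avg x n))) => //.
- by move=> n; exact: meas_step.
- exact: measD.
- apply: cvm_ext (cvmD (meas_Tn th ^~ x) (meas_Tn (negb \o th) ^~ x) my mz cy cz) => n u _.
  exact: Tn_compl.
move=> d e d0 e0.
have f0 : 0 < e * d / 2 by rewrite divr_gt0// mulr_gt0.
have [N /(_ N (leqnn N)) [c Hc]] := step_dense ix f0.
exists N => n Nn; set s := step N c in Hc.
have ss : is_step N c s by [].
have is1 : in_L1 s by exact: L1_step.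
have [c' ss'] := is_step_ge ss Nn.
have ixs : in_L1 (fun u => x u - s u) by exact: L1B.
have mxs := L1_meas ixs.
have iA (w : R -> R) : in_L1 (step n (avg w n)) by exact: L1_step.
have iR : in_L1 (fun u => (x u - s u) - step n (avg (fun u => x u - s u) n) u)
    by exact: L1B.
rewrite (@dist_eq _ _ (fun u => (x u - s u) - step n (avg (fun u => x u - s u) n) u));
    last first.
  move=> u Uu; rewrite -!(Tn_compl th) !TnB//.
  have : Tn th n s u + Tn (negb \o th) n s u = s u.
    by rewrite Tn_compl /step (avg_is_step ss') ?truncn_lt// -/(step n c' u) -ss'.
  lra.
rewrite -(ler_pM2l d0); apply: le_trans (markov01 iR d0) _.
apply: (@le_trans _ _ (int01 (fun u => `|x u - s u| + `|step n (avg (fun u => x u - s u)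
    n) u|))).
  apply: int01_le; [exact: L1_norm|by apply: L1D; apply: L1_norm|].
  by move=> u _; exact: ler_normB.
rewrite int01D; [|exact: L1_norm|exact: L1_norm].
have := mean_avg_norm n ixs; rewrite -(int01_step n (fun j => `|avg (fun u => x u - s u)
    n j|)).
rewrite /step in Hc *; lra.
Qed.

Lemma Tlim_dist th x y l e : Tlim th x y -> in_L1 x ->
  (forall n, dist (Tn th n x) l <= e) -> forall d, 0 < d -> dist y (l + d) <= e.
Proof.
move=> [my cy] ix H d d0; apply/ler_addgt0Pr => e' e'0.
have [n /(_ n (leqnn n)) Hn] := cy _ _ d0 e'0.
rewrite (_ : y = (fun u => Tn th n x u + (y u - Tn th n x u)));
    last by apply/funext => u; lra.
apply: le_trans (dist_add _ _ (meas_Tn _ _ _) _) _; first by apply: measB => //;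
    exact: meas_Tn.
exact: lerD.
Qed.

Lemma calderon_ge0 x t : in_L1 x -> 0 < t < 1 -> 0 <= calderon (rearr x) t.
Proof.
move=> ix /andP[t0 t1]; have mx := L1_meas ix; apply: addr_ge0.
  rewrite mulr_ge0 ?invr_ge0 ?(ltW t0)//; apply: Rintegral_ge0 => u /=;
      rewrite in_itv/= => /andP[u0 _].
  exact: rearr_ge0.
apply: Rintegral_ge0 => u /=; rewrite in_itv/= => /andP[tu _].
have u0 : 0 < u by exact: lt_trans tu.
by rewrite divr_ge0 ?(ltW u0)// rearr_ge0.
Qed.

Lemma Tlim_rearr th x y t : in_L1 x -> Tlim th x y -> 0 < t < 1 ->
  rearr y t <= 7 * calderon (rearr x) t.
Proof.
move=> ix Ty t01; have my := Ty.1; have c0 := calderon_ge0 ix t01.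
apply/ler_addgt0Pr => e e0; apply: rearr_le => //; first by lra.
have e20 : 0 < e / 2 by lra.
have := Tlim_dist Ty ix (fun n => Tn_calderon_bound th n ix t01 e20) e20.
by rewrite -addrA -splitr.
Qed.

Lemma calderonZ (a : R) x t : in_L1 x -> 0 < t < 1 -> 0 < a ->
  calderon (rearr (a \*o x)) t = a * calderon (rearr x) t.
Proof.
move=> ix /andP[t0 t1] a0; have mx := L1_meas ix.
have tU : `]0, t[ `<=` U by apply: itv_sub_unit => //; exact: ltW.
have tU' : `]t, 1[ `<=` U by apply: itv_sub_unit => //; exact: ltW.
have mt : ms01 (`]0, t[ : set R) by exact: ms01_itv.
rewrite /calderon !Rintegral_subE//.
have -> : int01 (fun u => rearr (a \*o x) u * \1_(`]0, t[ : set R) u) =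
    a * int01 (fun u => rearr x u * \1_(`]0, t[ : set R) u).
  rewrite -int01Z; last by apply: L1_mul_indic => //; exact: L1_rearr.
  by apply: int01_eq => u /unit_itvP/andP[u0 _]; rewrite rearrZ// mulrA.
have -> : int01 (fun u => rearr (a \*o x) u / u * \1_(`]t, 1[ : set R) u) =
    a * int01 (fun u => rearr x u / u * \1_(`]t, 1[ : set R) u).
  rewrite -int01Z; last exact: L1_rearr_div.
  by apply: int01_eq => u /unit_itvP/andP[u0 _]; rewrite rearrZ// !mulrA.
lra.
Qed.

Lemma Tlim_dominated th x y : in_L1 x -> Tlim th x y -> calderon_dominated y (7 \*o x).
Proof. by move=> ix Ty t t01; rewrite calderonZ//; exact: Tlim_rearr Ty t01. Qed.

Lemma Tlim_L1infty th x y : in_L1 x -> Tlim th x y -> in_L1infty y.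
Proof.
move=> ix Ty; have my := Ty.1; split => //.
pose I := int01 (fun u => `|x u|).
have I0 : 0 <= I by exact: int01_ge0.
exists (I + 2) => t /andP[t0 t1].
(* The weak type bound at level l gives measure at most t; adding 1 avoids l = 0. *)
pose l := (I + 1) / t.
have l0 : 0 < l by rewrite /l divr_gt0//; lra.
have tl : t * l = I + 1 by rewrite /l mulrC divfK// gt_eqF.
have H n : dist (Tn th n x) l <= t.
  rewrite -(ler_pM2l l0); apply: le_trans (Tn_weak th n ix l0) _.
  by rewrite mulrC tl -/I; lra.
have r : rearr y t <= l + 1.
  by apply: rearr_le => //; [lra|exact: (Tlim_dist Ty ix H ltr01)].
by have := ler_wpM2l (ltW t0) r; rewrite mulrDr tl; lra.
Qed.

(** The transform T on L_1, choosing a representative of each limit. *)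
Definition Tlimit th x : R -> R := xget (cst 0) (Tlim th x).

Lemma TlimitP th x : in_L1 x -> Tlim th x (Tlimit th x).
Proof. by move=> ix; apply: xgetPex; exact: Tlim_ex. Qed.

End Final.

(** * Characteristic functions in a separable symmetric space *)

Section Space.
Variable R : realType.
Implicit Types (x y : R -> R) (S : set R) (s t : R) (th : nat -> bool).
Notation mu := (@lebesgue_measure R).
Notation U := (@unit_itv R).
#[local] Hint Extern 0 (measurable _) => solve [apply: measurable_unit_itv] : core.
Variables (E : set (R -> R)) (N : (R -> R) -> R).
Hypothesis E_symm : quasi_banach_symmetric E N.

Lemma E_meas x : E x -> meas01 x.
Proof. exact: (qn_meas (qbs_space E_symm)). Qed.

Lemma E_ideal x y : E x -> meas01 y -> (forall u, U u -> `|y u| <= `|x u|) ->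
    E y /\ N y <= N x.
Proof. by move=> Ex my yx; apply: (qbs_ideal E_symm Ex my); exact: aeW. Qed.

Lemma dist_indic S s : 0 <= s -> dist (\1_S : R -> R) s = if s < 1 then msr S else 0.
Proof.
move=> s0; case: ifPn => s1.
  apply: msr_eq => u _; rewrite /dset/= indicE.
  split; first by case: (boolP (u \in S)) => [|_]; [rewrite inE|rewrite normr0 ltNge s0].
  by move=> Su; rewrite mem_set// normr1.
rewrite /dist (@msr_eq _ _ set0) ?/msr ?setI0 ?measure0// => u _; split => //.
by rewrite /dset/= => /lt_le_trans /(_ (indic_le1 _ _)); rewrite (negbTE s1).
Qed.

Lemma E_indic_symm S S' : ms01 S -> ms01 S' -> msr S = msr S' -> E (\1_S) ->
  E (\1_S') /\ N (\1_S') = N (\1_S).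
Proof.
move=> mS mS' SS ES; have m1 := meas_indic mS; have m2 := meas_indic mS'.
apply: (qbs_symmetric E_symm ES m2) => t /andP[t0 _].
by apply/eqP; rewrite eq_le !rearr_mono// => s s0; rewrite !dist_indic// SS.
Qed.

Lemma indic_le S S' u : (S u -> S' u) -> `|\1_S u| <= `|\1_S' u| :> R.
Proof.
move=> SS; rewrite !indicE; case: (boolP (u \in S)); last by rewrite normr0.
by rewrite inE => /SS Su; rewrite mem_set.
Qed.

Lemma E_indic_le S S' : ms01 S -> (forall u, U u -> S u -> S' u) -> E (\1_S') ->
  E (\1_S) /\ N (\1_S) <= N (\1_S').
Proof.
move=> mS SS ES'; apply: (E_ideal ES' (meas_indic mS)) => u Uu.
by apply: indic_le; exact: SS.
Qed.

Lemma E_sum (F : nat -> R -> R) m : (forall k, (k < m)%N -> E (F k)) ->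
  E (fun u => \sum_(k < m) F k u).
Proof.
elim: m => [|m ih] EF.
  rewrite (_ : (fun u => _) = cst 0); first exact: (qn_zero (qbs_space E_symm)).
  by apply/funext => u; rewrite big_ord0.
rewrite (_ : (fun u => _) = (fun u => \sum_(k < m) F k u) \+ F m).
  apply: (qn_add (qbs_space E_symm)); last exact: EF.
  by apply: ih => k km; apply: EF; exact: ltnW.
by apply/funext => u; rewrite big_ord_recr.
Qed.

Hypothesis E_nontrivial : exists2 x, E x & ~ eq01 x (cst 0).

(** Every bounded measurable function is in E: some positive multiple of 1_D,
    with D of positive measure, is at most |y| for a nonzero y in E, so by
    symmetry E contains the characteristic functions of the dyadic intervals of
    some level, and their sum. *)
Lemma E_bounded x (C : R) : meas01 x -> (forall u, U u -> `|x u| <= C) -> E x.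
Proof.
move=> mx xC; have [y Ey ny] := E_nontrivial; have my := E_meas Ey.
have [d d0 b0] : exists2 d, 0 < d & 0 < dist y d.
  apply: contrapT => H; apply: ny; apply: small_dist_eq0 => // d e d0 e0.
  have : ~ (0 < dist y d) by move=> b; apply: H; exists d.
  by move=> /negP; rewrite -leNgt => /le_trans; apply; exact: ltW.
set b := dist y d in b0.
have mS : ms01 (dset y d) by exact: ms01_dset.
have E1 : E (\1_(dset y d)).
  have Edy := qn_scale (qbs_space E_symm) d^-1 Ey.
  apply: (proj1 (E_ideal Edy (meas_indic mS) _)) => u _.
  rewrite indicE; case: (boolP (_ \in _)); last by rewrite normr0.
  rewrite inE /dset/= => /ltW dy; rewrite normr1 normrM normfV (gtr0_norm d0).
  by rewrite ler_pdivlMl// ?mulr1.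
have [n nb] := half_pow_small b0.
have b1 : b <= 1 by exact: dist_le1.
have E2 : E (\1_(`]0, b[ : set R)).
  apply: (proj1 (E_indic_symm mS _ _ E1)); first exact: ms01_itv.
  by rewrite msr_itv ?subr0// ltW.
have md j : ms01 (@dyad R n j) by apply: measurableI => //; exact: measurable_dyad.
have E3 : E (\1_(@dyad R n 0)).
  apply: (proj1 (E_indic_le (md 0%N) _ E2)) => u _.
  rewrite dyad_itv => -[/unit_itvP/andP[u0 _]] /=; rewrite !in_itv/= u0 => /andP[_ ub].
  by rewrite (lt_le_trans ub)// mul1r -exprVn.
have E4 j : (j < 2 ^ n)%N -> E (\1_(@dyad R n j)).
  move=> jn; apply: (proj1 (E_indic_symm (md 0%N) (md j) _ E3)).
  rewrite /msr !(setIidr (@dyad_sub_unit _ _ _)).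
  by rewrite (congr1 fine (mu_dyad _ jn)) (congr1 fine (mu_dyad _ _))// expn_gt0.
have E5 := qn_scale (qbs_space E_symm) C (E_sum E4).
apply: (proj1 (E_ideal E5 mx _)) => u Uu; apply: le_trans (xC u Uu) _.
rewrite /= (bigD1 (Ordinal (truncn_lt n Uu)))//= indicE mem_set//.
rewrite normrM; apply: le_trans (ler_norm _) _; rewrite ler_peMr// ger0_norm ?lerDl.
  by apply: sumr_ge0 => i _; rewrite indicE.
by rewrite addr_ge0//; apply: sumr_ge0 => i _; rewrite indicE.
Qed.

Lemma E_indic S : ms01 S -> E (\1_S).
Proof. by move=> mS; apply: (E_bounded (meas_indic mS)) => u _; exact: indic_le1. Qed.

Hypothesis E_separable : quasi_separable E N.

(** Otherwise all the functions 1_(0, t) would be at distance at least e from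
    each other, and separability would make (0, 1) countable. *)
Lemma indic_norm_small e : 0 < e -> exists2 eta, 0 < eta &
  forall S, ms01 S -> msr S <= eta -> N (\1_S) < e.
Proof.
move=> e0; apply: contrapT => H.
have Nge a b : 0 <= a -> a < b -> b <= 1 -> e <= N (\1_(`]a, b[ : set R)).
  move=> a0 ab b1; rewrite leNgt; apply/negP => Ne; apply: H.
  exists (b - a); first by rewrite subr_gt0.
  move=> S mS Sab; apply: le_lt_trans Ne.
  have S0 := msr_ge0 S.
  have [_ <-] : E (\1_(`]a, (a + msr S)[ : set R)) /\ N (\1_(`]a, (a + msr S)[ : set R))
      = N (\1_S).
    apply: E_indic_symm => //; [exact: ms01_itv| |exact: E_indic].
    by rewrite msr_itv//; lra.
  apply: (proj2 (E_indic_le _ _ _)); [exact: ms01_itv| |apply: E_indic; exact: ms01_itv].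
  by move=> u _ /=; rewrite !in_itv/= => /andP[-> ?]/=; lra.
have [d [Ed dense]] := E_separable.
have [K HK] := qn_quasi_triangle (qbs_space E_symm).
pose K1 := `|K| + 1.
have K10 : 0 < K1 by rewrite /K1; have := normr_ge0 K; lra.
have ee : 0 < e / (2 * K1) by rewrite divr_gt0// mulr_gt0.
pose f t : R -> R := \1_(`]0, t[ : set R).
have Ef t : E (f t) by apply: E_indic; exact: ms01_itv.
(* F t is the index of an element of the dense sequence close to 1_(0, t). *)
have /choice[F HF] : forall t, exists n, N (f t \- d n) < e / (2 * K1).
  by move=> t; exact: dense.
have key s t : 0 < s -> s < t -> t < 1 -> F s <> F t.
  move=> s0 st t1 Fst.
  have N1 : e <= N (f t \- f s).
    apply: le_trans (Nge s t (ltW s0) st (ltW t1)) _.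
    have E1 : E (f t \- f s).
      have := qn_add (qbs_space E_symm) (Ef t) (qn_scale (qbs_space E_symm) (-1) (Ef s)).
      by congr E; apply/funext => u /=; rewrite mulN1r.
    apply: (proj2 (E_ideal E1 _ _)); first by apply: meas_indic; exact: ms01_itv.
    move=> u /unit_itvP/andP[u0 _]; rewrite /f /= !indic_itv u0/=.
    case: (ltP s u) => su /=; last by rewrite normr0.
    have -> : (u < s) = false by apply/negbTE; rewrite -leNgt ltW.
    by rewrite subr0.
  have E1 n t' : E (f t' \- d n).
    have := qn_add (qbs_space E_symm) (Ef t') (qn_scale (qbs_space E_symm) (-1) (Ed n)).
    by congr E; apply/funext => u /=; rewrite mulN1r.
  have E2 := qn_scale (qbs_space E_symm) (-1) (E1 (F t) s).
  have N2 : N (f t \- f s) <= K * (N (f t \- d (F t)) + N ((-1) \*o (f s \- d (F t)))).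
    rewrite (_ : f t \- f s = (f t \- d (F t)) \+ ((-1) \*o (f s \- d (F t))));
        first exact: HK.
    by apply/funext => u /=; lra.
  have := HF t; have := HF s; rewrite Fst => Hs Ht.
  rewrite (qn_homogeneous (qbs_space E_symm)) ?normrN1 ?mul1r// in N2.
  have P1 := qn_ge0 (qbs_space E_symm) (E1 (F t) t).
  have P2 := qn_ge0 (qbs_space E_symm) (E1 (F t) s).
  move: N2; apply/negP; rewrite -ltNge; apply: lt_le_trans N1.
  apply: (@le_lt_trans _ _ (K1 * (N (f t \- d (F t)) + N (f s \- d (F t))))).
    by apply: ler_wpM2r; [exact: addr_ge0|rewrite /K1; have := ler_norm K; lra].
  have : K1 * (N (f t \- d (F t)) + N (f s \- d (F t))) < K1 * (e / (2 * K1)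
      + e / (2 * K1)).
    by rewrite ltr_pM2l//; lra.
  suff -> : K1 * (e / (2 * K1) + e / (2 * K1)) = e by [].
  rewrite invfM; have : K1 * K1^-1 = 1 by rewrite divff ?gt_eqF.
  move: K1^-1 => k kE; rewrite (_ : K1 * _ = e * (K1 * k)); last by lra.
  by rewrite kE mulr1.
have cU : countable U.
  apply/countable_injP; exists F => s t; rewrite !inE => /unit_itvP/andP[s0 s1]
      /unit_itvP/andP[t0 t1] Fst.
  by case: (ltgtP s t) => // st; exfalso; [apply: (key s t)|apply: (key t s)].
have := countable_lebesgue_measure0 cU; rewrite mu_unit_itv => /eqP.
by rewrite eqe oner_eq0.
Qed.

End Space.

(** * Narrowness *)

Section Narrow.
Variable R : realType.
Implicit Types (x y : R -> R) (S : set R) (s t : R) (th : nat -> bool).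
Notation mu := (@lebesgue_measure R).
Notation U := (@unit_itv R).
#[local] Hint Extern 0 (measurable _) => solve [apply: measurable_unit_itv] : core.

(** A martingale that vanishes at level n vanishes at all earlier levels, hence
    so does its transform. *)
Lemma mtransform_vanish th (f : nat -> nat -> R) n : dmart f ->
  (forall i, (i < 2 ^ n)%N -> f n i = 0) ->
  forall j, (j < 2 ^ n)%N -> mtransform th f n j = 0.
Proof.
elim: n => [|n ih] mf f0 j jn /=; first by rewrite f0//; case: ifP.
have fn0 i : (i < 2 ^ n)%N -> f n i = 0.
  move=> i2; rewrite mf !f0 ?addr0 ?mul0r//; rewrite expnS mul2n ?ltn_double ?ltn_Sdouble//.
have j2n : (j./2 < 2 ^ n)%N by rewrite ltn_half_double -mul2n -expnS.
by rewrite ih// add0r f0// fn0// subrr; case: ifP.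
Qed.

(** The step function with value b i on the left half and - b i on the right
    half of the i-th interval of level n, that is 1_B r if b is the characteristic
    function of a union B of intervals. *)
Definition flip n (b : nat -> R) : R -> R :=
  step n.+1 (fun j => b j./2 * (if odd j then -1 else 1)).

(** A function with all its martingale differences at level n + 1 is killed when
    n + 1 is not in th. *)
Lemma Tn_flip th n (b : nat -> R) m u : th n.+1 = false -> (n < m)%N -> U u ->
  Tn th m (flip n b) u = 0.
Proof.
move=> thn nm Uu.
have ss : is_step n.+1 (fun j => b j./2 * (if odd j then -1 else 1)) (flip n b) by [].
have iz : in_L1 (flip n b) by exact: L1_step.
have mz := avg_dmart iz.
rewrite (Tn_stab _ ss nm)// /Tn /step /= thn addr0.
apply: mtransform_vanish => //; last first.
  by rewrite ltn_half_double -mul2n -expnS truncn_lt.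
move=> i i2; rewrite mz !(avg_is_step ss) ?expnS ?mul2n ?ltn_double ?ltn_Sdouble//.
by rewrite /= odd_double uphalf_double doubleK/= mulr1 mulrN1 subrr mul0r.
Qed.

Variables (E : set (R -> R)) (N : (R -> R) -> R).
Hypothesis E_symm : quasi_banach_symmetric E N.
Hypothesis E_sub_L1 : E `<=` @in_L1 R.

Lemma calderon_norm_le x y : E y -> calderon_dominated x y -> calderon_norm E N x <= N y.
Proof.
move=> Ey xy; apply: ge_inf; last by exists y.
by exists 0 => _ [z [Ez _] <-]; exact: (qn_ge0 (qbs_space E_symm)).
Qed.

Lemma Tlimit_bounded th : bounded_linear_operator E N (calderon_space E)
    (calderon_norm E N) (Tlimit th).
Proof.
have qs := qbs_space E_symm.
split.
- move=> x Ex; have ix := E_sub_L1 Ex; have Tx := TlimitP th ix.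
  split; first exact: Tlim_L1infty Tx.
  exists (7 \*o x); first exact: (qn_scale qs).
  exact: Tlim_dominated Tx.
- move=> x y Ex Ey xy; have ix := E_sub_L1 Ex; have iy := E_sub_L1 Ey.
  exact: Tlim_unique (Tlim_ae ix iy xy (TlimitP th ix)) (TlimitP th iy).
- move=> x y Ex Ey; have ix := E_sub_L1 Ex; have iy := E_sub_L1 Ey.
  have ixy := E_sub_L1 (qn_add qs Ex Ey).
  exact: Tlim_unique (TlimitP th ixy) (Tlim_add ix iy (TlimitP th ix) (TlimitP th iy)).
- move=> a x Ex; have ix := E_sub_L1 Ex; have iax := E_sub_L1 (qn_scale qs a Ex).
  exact: Tlim_unique (TlimitP th iax) (Tlim_scale a ix (TlimitP th ix)).
exists 7 => x Ex; have ix := E_sub_L1 Ex.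
rewrite -[X in X * _](@ger0_norm R 7)// -(qn_homogeneous qs)//.
apply: calderon_norm_le; first exact: (qn_scale qs).
exact: Tlim_dominated (TlimitP th ix).
Qed.

Hypothesis E_nontrivial : exists2 x, E x & ~ eq01 x (cst 0).
Hypothesis E_separable : quasi_separable E N.

Lemma Tlimit_narrow th : (forall m, exists2 n, (m <= n)%N & th n.+1 = false) ->
  narrow_operator E N (calderon_space E) (calderon_norm E N) (Tlimit th).
Proof.
move=> thE; have qs := qbs_space E_symm; split; first exact: Tlimit_bounded.
move=> A mA AU eps eps0.
have mA1 : ms01 A by exact: measurableI.
have e7 : 0 < eps / 7 by rewrite divr_gt0.
have [eta eta0 small] := indic_norm_small E_symm E_nontrivial E_separable e7.
have eta4 : 0 < eta / 4 by rewrite divr_gt0.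
have [m Hm] := step_dense (L1_indic mA1) eta4.
have [n mn thn] := thE m; have [c Hc] := Hm n mn.
(* b rounds the step function c near 1_A to the characteristic function of B. *)
pose b j : R := (2^-1 < c j)%R%:R.
pose r : R -> R := step n.+1 (fun j => if odd j then -1 else 1).
pose x : R -> R := fun u => \1_A u * r u.
pose z := flip n b.
have r1 u : r u = 1 \/ r u = -1 by rewrite /r /step; case: ifP; [right|left].
have nr u : `|r u| = 1 by case: (r1 u) => ->; rewrite ?normrN normr1.
have mx : meas01 x by apply: measM; [exact: meas_indic|exact: meas_step].
have mz : meas01 z by exact: meas_step.
have x1 u : U u -> `|x u| <= 1 by move=> _; rewrite normrM nr mulr1; exact: indic_le1.
have Ex : E x by exact: (E_bounded E_symm E_nontrivial mx x1).
have [C HC] := step_bounded n.+1 (fun j => b j./2 * (if odd j then -1 else 1)).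
have Ez : E z by exact: (E_bounded E_symm E_nontrivial mz HC).
have mD : meas01 (fun u => \1_A u - step n c u).
  by apply: measB; [exact: meas_indic|exact: meas_step].
pose D := dset (fun u => \1_A u - step n c u) 4^-1.
have msD : ms01 D by exact: ms01_dset.
have iD : in_L1 (fun u => \1_A u - step n c u) by apply: L1B;
    [exact: L1_indic|exact: L1_step].
have De : msr D <= eta.
  have q : 0 < 4^-1 :> R by rewrite invr_gt0.
  have := markov01 iD q; rewrite -/(msr D) -/D /dist -/D; lra.
have ED := E_indic E_symm E_nontrivial msD.
(* Where 1_A and the step function c differ by at most 1/4, 1_A and 1_B are equal. *)
have xzD u : U u -> `|x u - z u| <= `|\1_D u|.
  move=> Uu.
  have -> : z u = b (Num.truncn (2 ^+ n * u)) * r u.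
    rewrite /z /flip /r /step (@truncn_half R n u)//.
    by move/unit_itvP: Uu => /andP[/ltW].
  rewrite -mulrBl normrM nr mulr1.
  case: (boolP (u \in D)) => [|/negP uD].
    move=> uD; rewrite [\1_D u]indicE uD normr1 indicE /b.
    by case: (_ \in A); case: (_ < _); rewrite ?subrr ?subr0 ?sub0r ?normrN ?normr0 ?normr1.
  have : ~ (4^-1 < `|\1_A u - step n c u|) by move=> H; apply: uD; rewrite inE.
  move=> /negP; rewrite -leNgt ler_norml => /andP[H1 H2].
  rewrite (_ : _ - _ = 0) ?normr0//; move: H1 H2; rewrite indicE /b /step.
  by case: (_ \in A) => /=; case: ltP => /=; lra.
have ixz : in_L1 (fun u => x u - z u) by apply: L1B; exact: E_sub_L1.
have [Exz Nxz] : E (fun u => x u - z u) /\ N (fun u => x u - z u) <= N (\1_D).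
  by apply: (E_ideal E_symm ED) => //; exact: measB.
exists x; split => //.
  split=> // t /unit_itvP Ut; split => At.
    by rewrite /x indicE mem_set// mul1r.
  by rewrite /x indicE memNset// mul0r.
apply: (@le_lt_trans _ _ (N (7 \*o (fun u => x u - z u)))); last first.
  rewrite (qn_homogeneous qs)// ger0_norm//; apply: (@le_lt_trans _ _ (7 * N (\1_D))).
    by rewrite ler_pM2l.
  by rewrite mulrC -ltr_pdivlMr//; exact: small.
apply: calderon_norm_le; first exact: (qn_scale qs).
apply: (@Tlim_dominated R th) => //.
have ix := E_sub_L1 Ex; have iz := E_sub_L1 Ez.
have [mTx cTx] := TlimitP th ix; split=> // d e d0 e0.
have [n0 H0] := cTx d e d0 e0; exists (maxn n0 n.+1) => k;
    rewrite geq_max => /andP[/H0 H nk].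
apply: le_trans H; rewrite le_eqVlt; apply/orP; left; apply/eqP/dist_eq => u Uu.
by rewrite TnB// (Tn_flip _ thn nk)// subr0.
Qed.

End Narrow.

Theorem theorem22 (R : realType) (E : set (R -> R)) (N : (R -> R) -> R)
    (E_symm : quasi_banach_symmetric E N)
    (E_nontrivial : exists2 x, E x & ~ eq01 x (cst 0))
    (E_separable : quasi_separable E N)
    (E_sub_L1 : E `<=` @in_L1 R) :
  exists T1 T2 : (R -> R) -> (R -> R),
    [/\ narrow_operator E N (calderon_space E) (calderon_norm E N) T1,
        narrow_operator E N (calderon_space E) (calderon_norm E N) T2
      & forall x, E x -> eq01 (T1 x \+ T2 x) x].
Proof.
exists (Tlimit odd), (Tlimit (negb \o odd)); split.
- apply: Tlimit_narrow => // m; exists m.*2.+1; first by rewrite -addnn -addnS leq_addr.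
  by rewrite /= odd_double.
- apply: Tlimit_narrow => // m; exists m.*2; first by rewrite -addnn leq_addr.
  by rewrite /= odd_double.
move=> x Ex; have ix := E_sub_L1 x Ex.
exact: Tlim_compl (TlimitP odd ix) (TlimitP (negb \o odd) ix).
Qed.
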